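(* Let $X$ be a random variable with mean $\mu$ and $\mathbb{E}X^4<\infty$, which is either (a) integer-valued with probability mass function $p$ having a Pearson quadratic form $q(j)=\delta(j-\mu)^2+\beta(j-\mu)+\gamma$, i.e. $\sum_{k\le j}(\mu-k)p(k)=q(j)p(j)$ for all $j\in\mathbb{Z}$, and with support $J(X)=\{j\in\mathbb{Z}:p(j)>0\}$ satisfying $|J(X)|\ge 3$; or (b) continuous with density $f$ having a Pearson quadratic form $q(x)=\delta(x-\mu)^2+\beta(x-\mu)+\gamma$, i.e. $\int_{-\infty}^{x}(\mu-t)f(t)\,dt=q(x)f(x)$ for all $x\in\mathbb{R}$. Let $X_1,\dots,X_n$ be a random sample from $X$ which, in case (a), contains at least three distinct values, and, in case (b), consists of at least three observations. Let $\overline{X}_n=\frac1n\sum_{j=1}^n X_j$, $m_{k;n}=\frac1n\sum_{j=1}^n (X_j-\overline{X}_n)^k$, and $\widehat{\Theta}_n=m_{4;n}m_{2;n}-m_{3;n}^2-m_{2;n}^3$. Then $\widehat{\Theta}_n$ is a positive number (in case (b), almost surely), and the moment estimators of $\delta,\beta,\gamma$ are: (a) in the integer-valued case, $\widehat{\delta}_n=\dfrac{2m_{4;n}m_{2;n}-3m_{3;n}^2-6m_{2;n}^3+m_{2;n}^2}{6\widehat{\Theta}_n}$, $\widehat{\beta}_n=\dfrac{m_{3;n}(1-2\widehat{\delta}_n)-m_{2;n}}{2m_{2;n}}=\dfrac{m_{4;n}m_{3;n}-3m_{4;n}m_{2;n}+3m_{3;n}^2+3m_{3;n}m_{2;n}^2-m_{3;n}m_{2;n}+3m_{2;n}^3}{6\widehat{\Theta}_n}$,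 $\widehat{\gamma}_n=m_{2;n}(1-\widehat{\delta}_n)=\dfrac{4m_{4;n}m_{2;n}^2-3m_{3;n}^2m_{2;n}-m_{2;n}^3}{6\widehat{\Theta}_n}$; (b) in the continuous case, $\widehat{\delta}_n=\dfrac{2m_{4;n}m_{2;n}-3m_{3;n}^2-6m_{2;n}^3}{6\widehat{\Theta}_n}$, $\widehat{\beta}_n=\dfrac{m_{3;n}(1-2\widehat{\delta}_n)}{2m_{2;n}}=\dfrac{m_{4;n}m_{3;n}+3m_{3;n}m_{2;n}^2}{6\widehat{\Theta}_n}$, $\widehat{\gamma}_n=m_{2;n}(1-\widehat{\delta}_n)=\dfrac{4m_{4;n}m_{2;n}^2-3m_{3;n}^2m_{2;n}}{6\widehat{\Theta}_n}$. Moreover, $\widehat{\delta}_n\to\delta$, $\widehat{\beta}_n\to\beta$, $\widehat{\gamma}_n\to\gamma$ almost surely as $n\to\infty$.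
   Context: A moment estimator here means the estimator obtained by replacing the central moments $\mu_k=\mathbb{E}(X-\mu)^k$, $k=2,3,4$, in the expressions for $\delta,\beta,\gamma$ as functions of $\mu_2,\mu_3,\mu_4$ (determined by the Pearson quadratic form identity) by the sample central moments $m_{k;n}$. *)

(* Defs.v *)
From HB Require Import structures.
From mathcomp Require Import all_boot all_order all_algebra.
From mathcomp Require Import all_classical all_reals all_analysis.
Set Implicit Arguments.
Unset Strict Implicit.
Unset Printing Implicit Defensive.
Import Order.TTheory GRing.Theory Num.Def Num.Theory.
Import numFieldNormedType.Exports.
Local Open Scope classical_set_scope.
Local Open Scope ring_scope.

Section defs.
Context {d : measure_display} {T : measurableType d} {R : realType}.
Variable P : probability T R.

(** Mutual independence of a sequence of real random variables:
    for every n, the family X_0, ..., X_{n-1} is independent, i.e.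
    P(/\_{i<n} X_i \in B_i) = prod_{i<n} P(X_i \in B_i) for all Borel B_i
    (taking B_i = R covers every finite subfamily). *)
Definition mutually_independent (Xs : nat -> {RV P >-> R}) : Prop :=
  forall (n : nat) (B : nat -> set R), (forall i, measurable (B i)) ->
    fine (P (\bigcap_(i in `I_n) (Xs i @^-1` B i)))
    = \prod_(i < n) fine (P (Xs i @^-1` B i)).

Definition random_sample (X : {RV P >-> R}) (Xs : nat -> {RV P >-> R}) : Prop :=
  mutually_independent Xs /\
  forall (i : nat) (A : set R), measurable A -> P (Xs i @^-1` A) = P (X @^-1` A).

Definition cmoment (X : {RV P >-> R}) (mu : R) (k : nat) : R :=
  fine ('E_P[fun t => ((X t - mu) ^+ k)%R])%E.

End defs.

Definition pearson_q {R : realType} (delta beta gamma mu x : R) : R :=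
  delta * (x - mu) ^+ 2 + beta * (x - mu) + gamma.

(** Discrete Pearson identity: sum_{k <= j} (mu - k) p(k) = q(j) p(j) for all
    integers j; the series over k <= j is written with k = j - i, i >= 0. *)
Definition pearson_discrete {R : realType} (p : int -> R)
    (delta beta gamma mu : R) : Prop :=
  forall j : int,
    (fun N : nat => \sum_(0 <= i < N) (mu - (j - i%:Z)%:~R) * p (j - i%:Z))
      @ \oo --> pearson_q delta beta gamma mu j%:~R * p j.

Definition pearson_continuous {R : realType} (f : R -> R)
    (delta beta gamma mu : R) : Prop :=
  forall x : R,
    (\int[@lebesgue_measure R]_(t in `]-oo, x]) ((mu - t) * f t)%:E)%E
      = (pearson_q delta beta gamma mu x * f x)%:E.

Definition sample_mean {T : Type} {R : realType} (Xs : nat -> T -> R)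
    (n : nat) (w : T) : R :=
  n%:R^-1 * \sum_(j < n) Xs j w.

Definition sample_cmoment {T : Type} {R : realType} (Xs : nat -> T -> R)
    (k n : nat) (w : T) : R :=
  n%:R^-1 * \sum_(j < n) (Xs j w - sample_mean Xs n w) ^+ k.

Definition ThetaF {R : realType} (m2 m3 m4 : R) : R :=
  m4 * m2 - m3 ^+ 2 - m2 ^+ 3.

Definition deltaA {R : realType} (m2 m3 m4 : R) : R :=
  (2 * m4 * m2 - 3 * m3 ^+ 2 - 6 * m2 ^+ 3 + m2 ^+ 2) / (6 * ThetaF m2 m3 m4).
Definition betaA {R : realType} (m2 m3 m4 : R) : R :=
  (m4 * m3 - 3 * m4 * m2 + 3 * m3 ^+ 2 + 3 * m3 * m2 ^+ 2 - m3 * m2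
     + 3 * m2 ^+ 3) / (6 * ThetaF m2 m3 m4).
Definition gammaA {R : realType} (m2 m3 m4 : R) : R :=
  (4 * m4 * m2 ^+ 2 - 3 * m3 ^+ 2 * m2 - m2 ^+ 3) / (6 * ThetaF m2 m3 m4).

Definition deltaB {R : realType} (m2 m3 m4 : R) : R :=
  (2 * m4 * m2 - 3 * m3 ^+ 2 - 6 * m2 ^+ 3) / (6 * ThetaF m2 m3 m4).
Definition betaB {R : realType} (m2 m3 m4 : R) : R :=
  (m4 * m3 + 3 * m3 * m2 ^+ 2) / (6 * ThetaF m2 m3 m4).
Definition gammaB {R : realType} (m2 m3 m4 : R) : R :=
  (4 * m4 * m2 ^+ 2 - 3 * m3 ^+ 2 * m2) / (6 * ThetaF m2 m3 m4).

(* Main.v *)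
(* Summation (resp. integration) by parts in the Pearson identity gives
   E[q(X) (g(X + 1) - g(X))] = E[(X - mu) g(X)] (resp. E[q(X) g'(X)]) for
   g(x) = (x - mu)^k, k = 1, 2, 3; for bounded truncations of g it is a finite
   sum (resp. Fubini), and dominated convergence removes the truncation, only
   the fourth moment being needed.  These are three linear equations in delta,
   beta, gamma, and eliminating beta and gamma leaves 6 Theta delta = numerator.
   Theta / mu_2 = E[((X - mu)^2 - (mu_3 / mu_2) (X - mu) - mu_2)^2] is positive
   because a quadratic has at most two roots, and the same holds for the
   empirical measure of a sample with three distinct values.

   Consistency is the continuous mapping theorem together with the strong law of
   large numbers for (X - mu)^k, k <= 4.  Only E X^4 is finite, so the law is
   needed for integrable variables; it is proved in Etemadi's way.  For Y >= 0
   truncated at level K, the sum of the variance of the truncated K-sample mean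
   and of the expected number of exceedances among K observations is at most
   E[min(K, Y^2 / K)], which is summable along a lacunary sequence of K, with
   sum at most C E[Y]; monotonicity of the partial sums fills the gaps. *)
Require Import Defs.
From HB Require Import structures.
From mathcomp Require Import all_boot all_order all_algebra.
From mathcomp Require Import all_classical all_reals all_analysis.
From mathcomp Require Import measurable_realfun ring lra zify.
Import Order.TTheory GRing.Theory Num.Def Num.Theory.
Import numFieldNormedType.Exports.
Local Open Scope classical_set_scope.
Local Open Scope ring_scope.

(** * The linear system for the parameters *)

Section pearson_system.
Context {R : realType}.
Implicit Types m dl bt gm : R.

(** The first equation yields [gm] and the second [bt], both in terms of [dl]. The third, multiplied
    by [2 * m2], is then linear in [dl] with leading coefficient 6 Theta. *)
Lemma pearson_solveA {m2 m3 m4 dl bt gm} : 0 < m2 -> 0 < ThetaF m2 m3 m4 ->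
  dl * m2 + gm = m2 ->
  2 * dl * m3 + 2 * bt * m2 + m2 = m3 ->
  3 * dl * m4 + 3 * bt * m3 + 3 * gm * m2 + 3 * dl * m3 + 3 * bt * m2 + m2
    = m4 ->
  [/\ dl = deltaA m2 m3 m4, bt = betaA m2 m3 m4 & gm = gammaA m2 m3 m4].
Proof.
move=> m20 T0 e1 e2 e3.
have m2n : m2 != 0 by rewrite gt_eqF.
have Tn : ThetaF m2 m3 m4 != 0 by rewrite gt_eqF.
have egm : gm = m2 - dl * m2 by rewrite -{1}e1; ring.
have ebt : bt = (m3 - m2 - 2 * dl * m3) / (2 * m2) by rewrite -{1}e2; field.
have edl : dl = deltaA m2 m3 m4.
  apply: (mulIf (x := 6 * ThetaF m2 m3 m4)).
    by rewrite mulf_neq0.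
  rewrite /deltaA divfK ?mulf_neq0//.
  move: e3; rewrite ebt egm => /(congr1 (fun z => 2 * m2 * z)).
  set L := 2 * m2 * _ => e3.
  have eL : L = dl * (6 * (m4 * m2 - m3 ^+ 2 - m2 ^+ 3))
     + (3 * m3 ^+ 2 + 6 * m2 ^+ 3 - m2 ^+ 2) by rewrite /L; field.
  by move: e3; rewrite eL => e3; rewrite /ThetaF; lra.
split => //.
- by rewrite ebt edl /betaA /deltaA; move: Tn; rewrite /ThetaF => Tn; field; rewrite m2n Tn.
- by rewrite egm edl /gammaA /deltaA; move: Tn; rewrite /ThetaF => Tn; field.
Qed.

Lemma pearson_solveB {m2 m3 m4 dl bt gm} : 0 < m2 -> 0 < ThetaF m2 m3 m4 ->
  dl * m2 + gm = m2 ->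
  2 * dl * m3 + 2 * bt * m2 = m3 ->
  3 * dl * m4 + 3 * bt * m3 + 3 * gm * m2 = m4 ->
  [/\ dl = deltaB m2 m3 m4, bt = betaB m2 m3 m4 & gm = gammaB m2 m3 m4].
Proof.
move=> m20 T0 e1 e2 e3.
have m2n : m2 != 0 by rewrite gt_eqF.
have Tn : ThetaF m2 m3 m4 != 0 by rewrite gt_eqF.
have egm : gm = m2 - dl * m2 by rewrite -{1}e1; ring.
have ebt : bt = (m3 - 2 * dl * m3) / (2 * m2) by rewrite -{1}e2; field.
have edl : dl = deltaB m2 m3 m4.
  apply: (mulIf (x := 6 * ThetaF m2 m3 m4)).
    by rewrite mulf_neq0.
  rewrite /deltaB divfK ?mulf_neq0//.
  move: e3; rewrite ebt egm => /(congr1 (fun z => 2 * m2 * z)).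
  set L := 2 * m2 * _ => e3.
  have eL : L = dl * (6 * (m4 * m2 - m3 ^+ 2 - m2 ^+ 3))
     + (3 * m3 ^+ 2 + 6 * m2 ^+ 3) by rewrite /L; field.
  by move: e3; rewrite eL => e3; rewrite /ThetaF; lra.
split => //.
- by rewrite ebt edl /betaB /deltaB; move: Tn; rewrite /ThetaF => Tn; field; rewrite m2n Tn.
- by rewrite egm edl /gammaB /deltaB; move: Tn; rewrite /ThetaF => Tn; field.
Qed.

Lemma betaA_alt {m2 m3 m4} : 0 < m2 -> 0 < ThetaF m2 m3 m4 ->
  betaA m2 m3 m4 = (m3 * (1 - 2 * deltaA m2 m3 m4) - m2) / (2 * m2).
Proof.
move=> /lt0r_neq0 m2n /lt0r_neq0; rewrite /betaA /deltaA /ThetaF => Tn.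
by field; rewrite m2n Tn.
Qed.

Lemma gammaA_alt {m2 m3 m4} : 0 < ThetaF m2 m3 m4 ->
  gammaA m2 m3 m4 = m2 * (1 - deltaA m2 m3 m4).
Proof.
by move=> /lt0r_neq0; rewrite /gammaA /deltaA /ThetaF => Tn; field.
Qed.

Lemma betaB_alt {m2 m3 m4} : 0 < m2 -> 0 < ThetaF m2 m3 m4 ->
  betaB m2 m3 m4 = m3 * (1 - 2 * deltaB m2 m3 m4) / (2 * m2).
Proof.
move=> /lt0r_neq0 m2n /lt0r_neq0; rewrite /betaB /deltaB /ThetaF => Tn.
by field; rewrite m2n Tn.
Qed.

Lemma gammaB_alt {m2 m3 m4} : 0 < ThetaF m2 m3 m4 ->
  gammaB m2 m3 m4 = m2 * (1 - deltaB m2 m3 m4).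
Proof.
by move=> /lt0r_neq0; rewrite /gammaB /deltaB /ThetaF => Tn; field.
Qed.

(** Subtracting two equations and dividing by the difference of the roots lowers the degree; doing
    so twice leaves [a] alone. *)
Lemma quadratic_three_roots (a b c x y z : R) :
  x != y -> x != z -> y != z ->
  a * x ^+ 2 + b * x + c = 0 -> a * y ^+ 2 + b * y + c = 0 ->
  a * z ^+ 2 + b * z + c = 0 -> a = 0.
Proof.
rewrite -!(subr_eq0 _ y) -!(subr_eq0 _ z) => xy xz yz ex ey ez.
have e1 : a * (x + y) + b = 0.
  apply: (mulfI xy); rewrite mulr0.
  by transitivity (a * x ^+ 2 + b * x + c - (a * y ^+ 2 + b * y + c));
    [ring|rewrite ex ey subrr].
have e2 : a * (x + z) + b = 0.
  apply: (mulfI xz); rewrite mulr0.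
  by transitivity (a * x ^+ 2 + b * x + c - (a * z ^+ 2 + b * z + c));
    [ring|rewrite ex ez subrr].
apply: (mulIf yz); rewrite mul0r.
by transitivity (a * (x + y) + b - (a * (x + z) + b)); [ring|rewrite e1 e2 subrr].
Qed.

End pearson_system.

(** * Complements on integration *)

Section integral_complements.
Context {d : measure_display} {T : measurableType d} {R : realType}.

Lemma integrable_dominated {mu : {measure set T -> \bar R}} (f g : T -> R) :
  measurable_fun setT f -> mu.-integrable setT (EFin \o g) ->
  (forall t, `|f t| <= g t) -> mu.-integrable setT (EFin \o f).
Proof.
move=> mf ig fg; apply: le_integrable ig => //; first exact/measurable_EFinP.
by move=> t _ /=; rewrite lee_fin (le_trans (fg t))// ler_norm.
Qed.

Lemma integrable_scale {mu : {measure set T -> \bar R}} (k : R) (f : T -> R) :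
  mu.-integrable setT (EFin \o f) ->
  mu.-integrable setT (EFin \o (fun t => k * f t)).
Proof. by move=> /(integrableZl _ k); apply; exact: measurableT. Qed.

Lemma Rintegral_sum {mu : {measure set T -> \bar R}} (I : Type) (s : seq I)
    (f : I -> T -> R) : (forall i, mu.-integrable setT (EFin \o f i)) ->
  \int[mu]_t (\sum_(i <- s) f i t) = \sum_(i <- s) \int[mu]_t f i t.
Proof.
move=> fi; elim: s => [|i s ih].
  under eq_Rintegral do rewrite big_nil.
  by rewrite /Rintegral integral0 big_nil.
under eq_Rintegral do rewrite big_cons.
rewrite RintegralD// ?big_cons ?ih//.
rewrite (_ : _ \o _ = fun t => \sum_(j <- s) (f j t)%:E)%E; last first.
  by apply/funext => t; rewrite sumEFin.
by apply: integrable_sum => // i0 _; exact: fi.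
Qed.

Lemma cvg_Rintegral {mu : {measure set T -> \bar R}} (h : nat -> T -> R)
    (f g : T -> R) : (forall n, measurable_fun setT (h n)) ->
  measurable_fun setT f -> mu.-integrable setT (EFin \o g) ->
  (forall t, h n t @[n --> \oo] --> f t) -> (forall n t, `|h n t| <= g t) ->
  \int[mu]_t h n t @[n --> \oo] --> \int[mu]_t f t.
Proof.
move=> mh mf ig hf hg.
have [] := @dominated_convergence _ T R mu setT measurableT
   (fun n => EFin \o h n) (EFin \o f) (EFin \o g).
- by move=> n; exact/measurable_EFinP.
- exact/measurable_EFinP.
- by apply: aeW => t _; apply/fine_cvgP; split; [exact: nearW|exact: hf].
- exact: ig.
- by apply: aeW => t n _ /=; rewrite lee_fin.
move=> fi _ hc; apply: fine_cvg.
by rewrite fineK//; exact: integrable_fin_num.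
Qed.

(** Tonelli bounds the integral of the series, which is therefore finite almost everywhere, and the
    terms of a convergent series tend to 0. In the strong law this takes the place of the Chebyshev
    and Borel-Cantelli steps. *)
Lemma ae_cvg0_sum_integral {mu : {measure set T -> \bar R}}
    (h : nat -> T -> R) (c : R) : (forall n, measurable_fun setT (h n)) ->
  (forall n t, 0 <= h n t) ->
  (forall N, \sum_(n < N) \int[mu]_t (h n t)%:E <= c%:E)%E ->
  {ae mu, forall t, h n t @[n --> \oo] --> 0}.
Proof.
move=> mh h0 hc.
pose H t := (\sum_(n <oo) (h n t)%:E)%E.
have H0 t : (0 <= H t)%E by apply: nneseries_ge0 => n _ _; rewrite lee_fin.
have mH : measurable_fun setT H.
  apply: ge0_emeasurable_sum => // [n t _ _|n _]; first by rewrite lee_fin.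
  exact/measurable_EFinP.
have iH : mu.-integrable setT H.
  apply/integrableP; split => //.
  under eq_integral do rewrite gee0_abs//.
  rewrite /H integral_nneseries//; last 2 first.
    by move=> n; exact/measurable_EFinP.
    by move=> n t _; rewrite lee_fin.
  apply: le_lt_trans (ltry c); apply: lime_le.
    by apply: is_cvg_nneseries => n _ _; apply: integral_ge0 => t _; rewrite lee_fin.
  by apply: nearW => N; rewrite big_mkord.
have := integrable_ae measurableT iH; apply: filterS => t /(_ I) Hfin.
apply: (@cvg_series_cvg_0 R R^o).
apply: nondecreasing_is_cvgn.
  by apply/nondecreasing_seqP => n; rewrite seriesSr lerDl.
exists (fine (H t)) => _ [N _ <-].
rewrite -lee_fin fineK// /series/= -sumEFin.
by apply: nneseries_lim_ge => n _ _; rewrite lee_fin.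
Qed.

(** For nonnegative functions both sides are integrals against the same image measure; the general
    case splits into positive and negative parts. *)
Lemma eq_distribution_integral {P : probability T R} (U V : {RV P >-> R})
    (f : R -> R) :
  (forall A : set R, measurable A -> P (U @^-1` A) = P (V @^-1` A)) ->
  measurable_fun setT f ->
  (\int[P]_t (f (U t))%:E = \int[P]_t (f (V t))%:E)%E.
Proof.
move=> UV mf.
have ge0 (g : R -> \bar R) : measurable_fun setT g -> (forall x, 0 <= g x)%E ->
    (\int[P]_t g (U t) = \int[P]_t g (V t))%E.
  move=> mg g0.
  rewrite -(ge0_integral_distribution U)// -(ge0_integral_distribution V)//.
  by apply: eq_measure_integral => A mA _; exact: UV.
have mEf : measurable_fun setT (EFin \o f) by exact/measurable_EFinP.
rewrite (integralE _ _ (fun t => (f (U t))%:E)) (integralE _ _ (fun t => (f (V t))%:E)).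
rewrite -![fun t => (f (_ t))%:E]/((EFin \o f) \o _).
rewrite (funepos_comp _ U) (funepos_comp _ V) (funeneg_comp _ U) (funeneg_comp _ V).
by rewrite (ge0 ((EFin \o f)^\+)%E)// ?(ge0 ((EFin \o f)^\-)%E)//;
  [exact: measurable_funeneg|exact: measurable_funepos].
Qed.

Lemma Rintegral_probability_cst {P : probability T R} (c : R) :
  \int[P]_t c = c.
Proof. by rewrite Rintegral_cst//= probability_setT mulr1. Qed.

End integral_complements.

(** * Pairs of independent random variables *)

Lemma bounded_integrable {d : measure_display} {T : measurableType d}
    {R : realType} {P : probability T R} (f : T -> R) (c : R) :
  measurable_fun setT f -> (forall t, `|f t| <= c) ->
  P.-integrable setT (EFin \o f).
Proof.
move=> mf fc; apply: measurable_bounded_integrable => //.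
  exact: (le_lt_trans (probability_le1 P measurableT) (ltry 1)).
rewrite /bounded_near; near=> M => t _ /=; apply: (le_trans (fc t)).
near: M; apply: nbhs_pinfty_ge; exact: num_real.
Unshelve. all: by end_near. Qed.

Section independent_pair.
Context {d : measure_display} {T : measurableType d} {R : realType}.
Context {P : probability T R}.

Lemma mutually_independent_pair (Xs : nat -> {RV P >-> R}) (i j : nat)
    (A B : set R) : mutually_independent Xs -> i != j ->
  measurable A -> measurable B ->
  P (Xs i @^-1` A `&` Xs j @^-1` B) =
    (P (Xs i @^-1` A) * P (Xs j @^-1` B))%E.
Proof.
move=> ind ij mA mB.
have mX k C : measurable C -> measurable (Xs k @^-1` C).
  by move=> mC; exact: measurable_funPTI.
pose n := (maxn i j).+1.
have ltin : (i < n)%N by rewrite ltnS leq_maxl.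
have ltjn : (j < n)%N by rewrite ltnS leq_maxr.
(* The indices other than [i] and [j] carry the full line, whose factor is 1. *)
pose F k := if k == i then A else if k == j then B else setT.
have mF k : measurable (F k) by rewrite /F; case: ifP => // _; case: ifP.
have Fi : F i = A by rewrite /F eqxx.
have Fj : F j = B by rewrite /F eq_sym (negbTE ij) eqxx.
have := ind n F mF.
have -> : \bigcap_(k in `I_n) (Xs k @^-1` F k) =
    Xs i @^-1` A `&` Xs j @^-1` B.
  apply/seteqP; split => [t Ft|t [tA tB] k _].
    by split; [move: (Ft i ltin)|move: (Ft j ltjn)]; rewrite ?Fi ?Fj.
  rewrite /F /=; case: eqVneq => [->//|_]; case: eqVneq => [->//|_//].
rewrite (bigD1 (Ordinal ltin))//= Fi.
rewrite (bigD1 (Ordinal ltjn))/=; last by rewrite -val_eqE/= eq_sym.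
rewrite Fj big1 ?mulr1 => [e|k /andP[ki kj]].
  rewrite -[LHS]fineK ?fin_num_measure//; last by apply: measurableI; exact: mX.
  by rewrite e EFinM !fineK ?fin_num_measure//; exact: mX.
rewrite /F -!val_eqE/= in ki kj *.
by rewrite (negbTE ki) (negbTE kj) preimage_setT probability_setT.
Qed.

Variables U V : {RV P >-> R}.
Hypothesis indUV : forall A B : set R, measurable A -> measurable B ->
  P (U @^-1` A `&` V @^-1` B) = (P (U @^-1` A) * P (V @^-1` B))%E.

Let W : T -> R * R := fun t => (U t, V t).

Let mW : measurable_fun setT W.
Proof. by apply: measurable_fun_pair. Qed.

HB.instance Definition _ := isMeasurableFun.Build _ _ _ _ W mW.

(** Rectangles determine the product measure, and on them independence gives the law of the pair. *)
Let joint_law (A : set (R * R)) : measurable A ->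
  (distribution P U \x distribution P V)%E A = P (W @^-1` A).
Proof.
move=> mA.
have -> : P (W @^-1` A) = distribution P (W : {RV P >-> _}) A by [].
exact: product_measure_unique.
Qed.

(** Fubini for the product law: each section of the diagonal is a single point, which is null for
    the law of [V]. *)
Lemma independent_eq_negligible :
  (forall x, P (V @^-1` [set x]) = 0%E) -> P [set t | U t = V t] = 0%E.
Proof.
move=> V0.
pose D := [set z : R * R | z.1 = z.2].
have mD : measurable D.
  have -> : D = (fun z : R * R => z.1 - z.2) @^-1` [set 0].
    by apply/seteqP; split => z /=; [move=> ->; rewrite subrr|move/subr0_eq].
  by rewrite -[X in measurable X]setTI; apply: measurable_funB.
have <- : P (W @^-1` D) = P [set t | U t = V t] by [].
rewrite -joint_law// /product_measure1/=.
rewrite integral0_eq// => x _ /=.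
rewrite -[RHS](V0 x); congr (P _).
apply/seteqP; split => t /=; rewrite /xsection/= inE /D/= => //.
Qed.

(** The integrals move to the laws on the line, where the joint law is a product measure and Fubini
    applies to the bounded integrand. *)
Lemma independent_integralM (phi psi : R -> R) (a b : R) :
  measurable_fun setT phi -> measurable_fun setT psi ->
  (forall x, `|phi x| <= a) -> (forall x, `|psi x| <= b) ->
  (\int[P]_t (phi (U t) * psi (V t)) =
     (\int[P]_t phi (U t)) * \int[P]_t psi (V t))%R.
Proof.
move=> mphi mpsi phia psib.
have mh : measurable_fun setT (fun z : R * R => phi z.1 * psi z.2).
  by apply: measurable_funM; exact: measurableT_comp.
have hb z : `|phi z.1 * psi z.2| <= a * b.
  by rewrite normrM ler_pM.
have intE (f : R -> R) c (X : {RV P >-> R}) : measurable_fun setT f ->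
    (forall x, `|f x| <= c) ->
    (\int[P]_t (f (X t))%:E = \int[distribution P X]_x (f x)%:E)%E.
  move=> mf fc; rewrite integral_pushforward//; first exact/measurable_EFinP.
  apply: (@bounded_integrable _ _ _ _ (f \o X) c); first exact: measurableT_comp.
  by move=> t; exact: fc.
rewrite /Rintegral (intE _ _ _ mphi phia) (intE _ _ _ mpsi psib).
have -> : (\int[P]_t (phi (U t) * psi (V t))%:E =
   \int[distribution P (W : {RV P >-> _})]_z (phi z.1 * psi z.2)%:E)%E.
  rewrite integral_pushforward//; first exact/measurable_EFinP.
  apply: (@bounded_integrable _ _ _ _ (fun t => phi (U t) * psi (V t)) (a * b)).
    exact: (measurableT_comp mh mW).
  by move=> t; exact: (hb (U t, V t)).
rewrite (eq_measure_integral (distribution P U \x distribution P V)%E); last first.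
  by move=> A mA _; exact/esym/joint_law.
have iU : (distribution P U).-integrable setT (EFin \o phi).
  exact: bounded_integrable phia.
have iV : (distribution P V).-integrable setT (EFin \o psi).
  exact: bounded_integrable psib.
have hint : (distribution P U \x distribution P V)%E.-integrable setT
    (EFin \o (fun z : R * R => phi z.1 * psi z.2)).
  apply: measurable_bounded_integrable => //.
    have e := @joint_law setT; rewrite preimage_setT in e.
    apply: (@le_lt_trans _ _ (P setT)); first by rewrite -e.
    exact: (le_lt_trans (probability_le1 P measurableT) (ltry 1)).
  rewrite /bounded_near; near=> M => z _ /=; apply: (le_trans (hb z)).
  by near: M; apply: nbhs_pinfty_ge; exact: num_real.
rewrite -integral12_prod_meas1//.
under eq_integral do rewrite /fubini_F/=.
under eq_integral => x _.
  under eq_integral do rewrite EFinM.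
  rewrite integralZl//.
  rewrite -[X in (_ * X)%E]fineK; last exact: integrable_fin_num.
  over.
rewrite integralZr//= fineM//; exact: integrable_fin_num.
Unshelve. all: by end_near. Qed.

End independent_pair.

(** * Lacunary subsequences *)

Section geometric_subsequence.
Context {R : realType}.

(** An integer stand-in for a geometric sequence. Starting at [m] makes every increment at least 1
    when [m > 0], so that the ratios stay between 1 + 1/(2m) and 1 + 1/m. *)
Fixpoint lacunary (m n : nat) : nat :=
  if n is n'.+1 then (lacunary m n' + lacunary m n' %/ m)%N else m.

Lemma lacunary_ge m n : (m <= lacunary m n)%N.
Proof. by elim: n => //= n /leq_trans; apply; exact: leq_addr. Qed.

Lemma lacunaryS_gt m n : (0 < m)%N -> (lacunary m n < lacunary m n.+1)%N.
Proof. by move=> m0 /=; rewrite -ltn_subLR// subnn divn_gt0// lacunary_ge. Qed.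

Lemma lacunaryS_le m n : (0 < m)%N ->
  (lacunary m n.+1)%:R <= (1 + m%:R^-1) * (lacunary m n)%:R :> R.
Proof.
move=> m0 /=; rewrite natrD mulrDl mul1r lerD2l ler_pdivlMl ?ltr0n// -natrM ler_nat.
by rewrite mulnC leq_divM.
Qed.

(** Rounding down loses at most half of the quotient, because a term is at least [m] and its
    quotient by [m] at least 1. *)
Lemma lacunaryS_ge m n : (0 < m)%N ->
  (1 + (2 * m%:R)^-1) * (lacunary m n)%:R <= (lacunary m n.+1)%:R :> R.
Proof.
move=> m0 /=; rewrite natrD mulrDl mul1r lerD2l ler_pdivrMl; last first.
  by rewrite mulr_gt0// ltr0n.
rewrite -!natrM ler_nat.
have km := lacunary_ge m n; set k := lacunary m n in km *.
have := divn_gt0 k m0; rewrite km => q0.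
have := ltn_mod k m; rewrite m0 => r; have := divn_eq k m.
by set q := (k %/ m)%N in q0 *; nia.
Qed.

Lemma lacunary_geq_id m n : (0 < m)%N -> (n <= lacunary m n)%N.
Proof.
move=> m0; elim: n => // n ih.
exact: (leq_ltn_trans ih (lacunaryS_gt m n m0)).
Qed.

Lemma lacunary_bracket m n0 N : (0 < m)%N -> (lacunary m n0 <= N)%N ->
  exists n, [/\ (n0 <= n)%N, (lacunary m n <= N)%N & (N < lacunary m n.+1)%N].
Proof.
move=> m0 kN.
have ex : exists n, (lacunary m n <= N)%N by exists n0.
have ub n : (lacunary m n <= N)%N -> (n <= N)%N.
  by move=> /(leq_trans _); apply; exact: lacunary_geq_id.
exists (ex_maxn ex ub); case: ex_maxnP => n nN nmax; split => //.
  exact: nmax.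
by rewrite ltnNge; apply/negP => /nmax; rewrite ltnn.
Qed.

(* The summands telescope: each is at most G (k n.+1) - G (k n) with
   G t = C * y * t / (y + t) and C the constant of the statement. *)
Lemma sum_min_geometric_le (al y : R) (k : nat -> R) N : 1 < al -> 0 <= y ->
  (forall n, 0 < k n) -> (forall n, al * k n <= k n.+1) ->
  \sum_(i < N) Num.min (k i) (y ^+ 2 / k i) <= 2 * (1 + al) / (al - 1) * y.
Proof.
move=> al1 y0 k0 kS.
have al10 : 0 < al - 1 by rewrite subr_gt0.
have C0 : 0 <= 2 * (1 + al) / (al - 1) by rewrite divr_ge0//; lra.
move: y0; rewrite le_eqVlt => /predU1P[<-|y0].
  rewrite mulr0 big1// => i _; rewrite expr0n/= mul0r; apply/min_idPr.
  exact: ltW.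
move: C0; set C := 2 * (1 + al) / (al - 1); move: (erefl C).
rewrite {2}/C; move: C => C EC C0.
pose G t := C * y * t / (y + t).
have step s t : 0 < t -> al * t <= s ->
    Num.min t (y ^+ 2 / t) <= G s - G t.
  move=> t0 ts.
  have s0 : 0 < s by apply: lt_le_trans ts; rewrite mulr_gt0//; lra.
  have alt0 : 0 < al * t by rewrite mulr_gt0//; lra.
  have GM : G (al * t) <= G s.
    rewrite /G -![C * y * _ / _]mulrA ler_wpM2l ?mulr_ge0 ?(ltW y0)//.
    rewrite ler_pdivrMr ?addr_gt0// mulrAC ler_pdivlMr ?addr_gt0//.
    by rewrite !mulrDr (mulrC s (al * t)) lerD2r ler_wpM2r// ltW.
  apply: (@le_trans _ _ (G (al * t) - G t)); last by rewrite lerB.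
  have -> : G (al * t) - G t =
      (2 * (1 + al) * y ^+ 2 * t) / ((y + al * t) * (y + t)).
    by rewrite /G EC; field; do ?[apply/andP; split]; apply/lt0r_neq0; lra.
  rewrite ler_pdivlMr; last by rewrite mulr_gt0// addr_gt0.
  (* For t <= y the minimum is bounded by t, and (y + al t)(y + t) by (1 + al) y times 2y. For t > y
     it is bounded by y^2 / t, with y and t exchanged in the second bound. *)
  have [ty|yt] := lerP t y.
    apply: (@le_trans _ _ (t * ((y + al * t) * (y + t)))).
      rewrite ler_wpM2r ?ge_min ?lexx// mulr_ge0// addr_ge0// ltW//.
    rewrite [leRHS]mulrC ler_wpM2l ?(ltW t0)//.
    have h1 : y + al * t <= (1 + al) * y.
      by rewrite mulrDl mul1r lerD2l ler_wpM2l//; lra.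
    have h2 : y + t <= 2 * y by lra.
    have -> : 2 * (1 + al) * y ^+ 2 = ((1 + al) * y) * (2 * y) by ring.
    by apply: ler_pM; rewrite // addr_ge0// ltW.
  apply: (@le_trans _ _ (y ^+ 2 / t * ((y + al * t) * (y + t)))).
    rewrite ler_wpM2r ?ge_min ?lexx ?orbT// mulr_ge0// addr_ge0// ltW//.
  have -> : 2 * (1 + al) * y ^+ 2 * t = y ^+ 2 / t * (((1 + al) * t) * (2 * t)).
    by field; rewrite gt_eqF.
  rewrite ler_wpM2l ?divr_ge0 ?sqr_ge0 ?(ltW t0)//.
  apply: ler_pM; rewrite ?addr_ge0 ?(ltW y0) ?(ltW alt0) ?(ltW t0)//.
    by rewrite mulrDl mul1r lerD2r ltW.
  by rewrite mulrDl mul1r lerD2r ltW.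
apply: (@le_trans _ _ (\sum_(i < N) (G (k i.+1) - G (k i)))).
  by apply: ler_sum => i _; exact: step.
rewrite -(big_mkord xpredT (fun i => G (k i.+1) - G (k i))) (telescope_sumr (fun i => G (k i)))//.
apply: (@le_trans _ _ (G (k N))).
  rewrite gerBl /G divr_ge0 ?mulr_ge0 ?addr_ge0// ltW//.
rewrite /G ler_pdivrMr ?addr_gt0//.
by rewrite ler_wpM2l ?mulr_ge0 ?(ltW y0)// lerDr ltW.
Qed.

(** For N between two consecutive lacunary terms, monotonicity of [s] puts s N / N between (1 - 1/m)
    times the average at the lower term and (1 + 1/m) times the average at the upper one. *)
Lemma cvg_average_lacunary (s : nat -> R) (mu : R) :
  (forall i, 0 <= s i) -> {homo s : i j / (i <= j)%N >-> i <= j} ->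
  (forall m, (0 < m)%N ->
    s (lacunary m n) / (lacunary m n)%:R @[n --> \oo] --> mu) ->
  s n / n%:R @[n --> \oo] --> mu.
Proof.
move=> s0 sm cs; apply/cvgrPdist_le => e e0.
have mu0 : 0 <= mu.
  have c1 := cs 1%N isT.
  rewrite -(cvg_lim _ c1)//; apply: limr_ge; first exact: cvgP c1.
  by near=> n; rewrite divr_ge0.
(* Large enough for the relative error 1/m of an average below mu + 1 to cost at most e/2. *)
pose m := (Num.truncn (2 * (mu + 1) / e)).+1.
have m0 : (0 < m)%N by [].
have mR0 : 0 < m%:R :> R by rewrite ltr0n.
have mle : (mu + 1) / m%:R <= e / 2.
  have : 2 * (mu + 1) / e < m%:R by exact: truncnS_gt.
  by rewrite ltr_pdivrMr// ler_pdivrMr// => h; lra.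
have /cvgrPdist_le cm := cs m m0.
(* The cap at 1 keeps the averages below mu + 1, the value for which [m] was chosen. *)
pose dl := Num.min (e / 2) 1.
have dl0 : 0 < dl by rewrite lt_min divr_gt0/=.
have [n0 _ hn0] := cm dl dl0.
exists (lacunary m n0) => // N /= kN.
have [n [n0n knN Nkn]] := lacunary_bracket m n0 N m0 kN.
have kpos j : 0 < (lacunary m j)%:R :> R.
  by rewrite ltr0n (leq_trans m0)// lacunary_ge.
have N0 : 0 < N%:R :> R by apply: lt_le_trans (kpos n) _; rewrite ler_nat.
have kk := @lacunaryS_le m n m0.
have bnd j : (n0 <= j)%N -> mu - e / 2 <= s (lacunary m j) / (lacunary m j)%:R <= mu + e / 2
   /\ s (lacunary m j) / (lacunary m j)%:R <= mu + 1.
  move=> n0j; have := hn0 j n0j; rewrite /= ler_distl => /andP[h1 h2].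
  have dl1 : dl <= e / 2 by rewrite ge_min lexx.
  have dl2 : dl <= 1 by rewrite ge_min lexx orbT.
  by split; [apply/andP; split|]; lra.
have im : 0 <= m%:R^-1 :> R by rewrite invr_ge0 ltW.
rewrite ler_distl; apply/andP; split.
- have [/andP[_ h1] h2] := bnd n.+1 (leqW n0n).
  set x := s (lacunary m n.+1) / _ in h1 h2.
  have x0 : 0 <= x by rewrite divr_ge0.
  have h3 : s N / N%:R <= (1 + m%:R^-1) * x.
    rewrite ler_pdivrMr//; apply: (@le_trans _ _ (x * (lacunary m n.+1)%:R)).
      by rewrite divfK ?gt_eqF//; apply: sm; exact: ltnW.
    rewrite [leRHS]mulrAC mulrC ler_wpM2r//; apply: (le_trans kk).
    by rewrite ler_wpM2l ?addr_ge0// ler_nat.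
  have h4 : x / m%:R <= (mu + 1) / m%:R by rewrite ler_wpM2r.
  move: h3; rewrite mulrDl mul1r (mulrC _ x); lra.
- have [/andP[h1 _] h2] := bnd n n0n.
  set x := s (lacunary m n) / _ in h1 h2.
  have x0 : 0 <= x by rewrite divr_ge0.
  have h3 : (1 - m%:R^-1) * x <= s N / N%:R.
    rewrite ler_pdivlMr//; apply: (@le_trans _ _ (x * (lacunary m n)%:R)).
      rewrite mulrAC mulrC ler_wpM2l//.
      (* Since N is below the next term and (1 - 1/m)(1 + 1/m) <= 1, the product (1 - 1/m) N is at
         most the current term; this is immediate when 1 - 1/m <= 0. *)
      have [mi|mi] := lerP (1 - m%:R^-1 : R) 0.
        apply: (@le_trans _ _ 0); first by rewrite mulr_le0_ge0.
        exact: ltW.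
      apply: (@le_trans _ _ ((1 - m%:R^-1) * ((1 + m%:R^-1) * (lacunary m n)%:R))).
        rewrite ler_wpM2l ?(ltW mi)//; apply: le_trans kk.
        by rewrite ler_nat ltnW.
      rewrite mulrA ler_piMl ?(ltW (kpos _))//.
      have -> : (1 - m%:R^-1) * (1 + m%:R^-1) = 1 - m%:R^-1 ^+ 2 :> R by ring.
      by rewrite gerBl sqr_ge0.
    by rewrite divfK ?gt_eqF//; exact: sm.
  have h4 : x / m%:R <= (mu + 1) / m%:R by rewrite ler_wpM2r.
  move: h3; rewrite mulrBl mul1r (mulrC _ x); lra.
Unshelve. all: by end_near. Qed.

End geometric_subsequence.

(** * The strong law of large numbers *)

Section strong_law.
Context {d : measure_display} {T : measurableType d} {R : realType}.
Context {P : probability T R}.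
Variables (X : {RV P >-> R}) (Xs : nat -> {RV P >-> R}).
Hypothesis sampleX : random_sample X Xs.

Let law_Xs i (A : set R) : measurable A -> P (Xs i @^-1` A) = P (X @^-1` A).
Proof. exact: sampleX.2. Qed.

Let Rintegral_Xs i (f : R -> R) : measurable_fun setT f ->
  \int[P]_t f (Xs i t) = \int[P]_t f (X t).
Proof.
by move=> mf; rewrite /Rintegral (eq_distribution_integral (Xs i) X f)//; exact: law_Xs.
Qed.

Let mcomp (f : R -> R) (V : {RV P >-> R}) : measurable_fun setT f ->
  measurable_fun setT (fun t => f (V t)).
Proof. by move=> mf; exact: measurableT_comp. Qed.

Let ibnd (f : R -> R) (c : R) (V : {RV P >-> R}) : measurable_fun setT f ->
  (forall x, `|f x| <= c) -> P.-integrable setT (EFin \o (fun t => f (V t))).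
Proof.
by move=> mf fc; apply: (bounded_integrable _ c) => //; exact: mcomp.
Qed.

(** Off the diagonal the expectation of the product factorises by independence and vanishes by
    centring; the K diagonal terms have the law of [X]. *)
Lemma Rintegral_sqr_centered_sum (z : R -> R) (c : R) (K : nat) :
  measurable_fun setT z -> (forall x, `|z x| <= c) ->
  \int[P]_t z (X t) = 0 ->
  \int[P]_t ((\sum_(i < K) z (Xs i t)) ^+ 2) =
    K%:R * \int[P]_t (z (X t) ^+ 2).
Proof.
move=> mz zc z0.
have izz i j : P.-integrable setT (EFin \o (fun t => z (Xs i t) * z (Xs j t))).
  apply: (bounded_integrable _ (c * c)).
    by apply: measurable_funM; exact: mcomp.
  by move=> t; rewrite normrM ler_pM.
under eq_Rintegral => t _.
  rewrite expr2 mulr_suml.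
  under eq_bigr do rewrite mulr_sumr.
  rewrite pair_bigA/=.
  over.
rewrite (Rintegral_sum _ _ (fun (p : 'I_K * 'I_K) t => z (Xs p.1 t) * z (Xs p.2 t)))//.
rewrite -(pair_bigA _ (fun i j : 'I_K => \int[P]_t (z (Xs i t) * z (Xs j t))))/=.
transitivity (\sum_(i < K) \int[P]_t (z (X t) ^+ 2)); last first.
  by rewrite sumr_const card_ord mulr_natl.
apply: eq_bigr => i _; rewrite (bigD1 i)//= big1 ?addr0 => [|j ji].
  by rewrite -(Rintegral_Xs i (fun x => z x ^+ 2))//; exact: measurable_funX.
rewrite (independent_integralM (Xs i) (Xs j) _ z z c c)//.
  by rewrite (Rintegral_Xs i z)// z0 mul0r.
move=> A B mA mB; apply: mutually_independent_pair => //; first exact: sampleX.1.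
by rewrite eq_sym.
Qed.

(** * The strong law for nonnegative functions of the observations, by truncation *)

Section nonnegative.
Variable phi : R -> R.
Hypothesis mphi : measurable_fun setT phi.
Hypothesis phi0 : forall x, 0 <= phi x.
Hypothesis iphi : P.-integrable setT (EFin \o (fun t => phi (X t))).

Let trunc (K : nat) (x : R) := phi x * \1_(`]-oo, K%:R]%classic) (phi x).
Let excess (K : nat) (x : R) : R := \1_(`]K%:R, +oo[%classic) (phi x).
Let mean (K : nat) := \int[P]_t trunc K (X t).
Let psi (K : nat) (x : R) := Num.min K%:R (phi x ^+ 2 / K%:R).
(** One quantity for two purposes: its convergence to 0 gives the limit of the truncated means and
    forces the number of exceedances, an integer, to be 0 eventually. *)
Let dev (K : nat) t := (K%:R^-1 * \sum_(i < K) trunc K (Xs i t) - mean K) ^+ 2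
   + \sum_(i < K) excess K (Xs i t).

Let mtrunc K : measurable_fun setT (trunc K).
Proof.
by apply: measurable_funM => //; apply: measurableT_comp => //; exact: measurable_indic.
Qed.

Let mexcess K : measurable_fun setT (excess K).
Proof. by apply: measurableT_comp => //; exact: measurable_indic. Qed.

Let mpsi K : measurable_fun setT (psi K).
Proof.
apply: measurable_minr; first exact: measurable_cst.
by apply: measurable_funM; [exact: measurable_funX|exact: measurable_cst].
Qed.

Let truncE K x : trunc K x = if phi x <= K%:R then phi x else 0.
Proof.
rewrite /trunc indicE mem_setE in_itv/=.
by case: ifP => _; rewrite ?mulr1 ?mulr0.
Qed.

Let excessE K x : excess K x = ((K%:R < phi x)%R : bool)%:R.
Proof. by rewrite /excess indicE mem_setE in_itv/= andbT. Qed.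

Let trunc_ge0 K x : 0 <= trunc K x.
Proof. by rewrite truncE; case: ifP. Qed.

Let trunc_le K x : trunc K x <= K%:R.
Proof. by rewrite truncE; case: ifP. Qed.

Let trunc_bnd K x : `|trunc K x| <= K%:R.
Proof. by rewrite ger0_norm. Qed.

(** Exactly one of the two terms is active: below the level K the minimum is phi^2 / K, above it the
    minimum is K. *)
Let psiE K x : (0 < K)%N -> K%:R * excess K x + K%:R^-1 * trunc K x ^+ 2 = psi K x.
Proof.
move=> K0; have KR : 0 < K%:R :> R by rewrite ltr0n.
rewrite excessE truncE /psi; case: lerP => h.
  rewrite mulr0 add0r mulrC; apply/esym/min_idPr.
  by rewrite ler_pdivrMr// expr2 ler_pM.
rewrite mulr1 expr0n/= mulr0 addr0; apply/esym/min_idPl.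
by rewrite ler_pdivlMr// -expr2 ler_sqr ?nnegrE// ltW.
Qed.

Let mdev K : measurable_fun setT (dev K).
Proof.
apply: measurable_funD.
  apply: measurable_funX; apply: measurable_funB => //.
  apply: measurable_funM => //; apply: measurable_sum => i; exact: mcomp.
by apply: measurable_sum => i; exact: mcomp.
Qed.

Let dev_ge0 K t : 0 <= dev K t.
Proof.
by rewrite addr_ge0 ?sqr_ge0// sumr_ge0// => i _; rewrite excessE ler0n.
Qed.

Let itrunc K (V : {RV P >-> R}) : P.-integrable setT (EFin \o (fun t => trunc K (V t))).
Proof. exact: (ibnd (trunc K) K%:R). Qed.

Let iexcess K (V : {RV P >-> R}) : P.-integrable setT (EFin \o (fun t => excess K (V t))).
Proof.
apply: (ibnd (excess K) 1) => // x; rewrite excessE ger0_norm ?ler0n//.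
by rewrite -[leRHS](mulr1n 1) ler_nat leq_b1.
Qed.

Let mean_bnd K : 0 <= mean K <= K%:R.
Proof.
apply/andP; split; first exact: Rintegral_ge0.
rewrite -[leRHS](@Rintegral_probability_cst _ _ _ P).
apply: le_Rintegral => //.
by apply: (bounded_integrable _ K%:R) => // t; rewrite ger0_norm.
Qed.

(** The truncated mean has variance at most E[trunc^2] / K, and the expected number of exceedances
    is K P(phi > K); [psiE] adds up the two. *)
Let integral_dev K : (0 < K)%N -> \int[P]_t dev K t <= \int[P]_t psi K (X t).
Proof.
move=> K0; have KR : 0 < K%:R :> R by rewrite ltr0n.
have KRn : K%:R != 0 :> R by rewrite gt_eqF.
pose z x := trunc K x - mean K.
have mz : measurable_fun setT z by apply: measurable_funB.
have zc x : `|z x| <= K%:R.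
  have /andP[m0 mK] := mean_bnd K.
  have := trunc_ge0 K x; have := trunc_le K x; rewrite /z ler_norml; lra.
have z0 : \int[P]_t z (X t) = 0.
  rewrite RintegralB//; last by apply: (bounded_integrable _ `|mean K|).
  by rewrite Rintegral_probability_cst subrr.
have zsq (V : {RV P >-> R}) : P.-integrable setT (EFin \o (fun t => z (V t) ^+ 2)).
  apply: (ibnd (fun x => z x ^+ 2) (K%:R ^+ 2)); first exact: measurable_funX.
  by move=> x; rewrite normrX lerXn2r ?nnegrE.
have tsq (V : {RV P >-> R}) : P.-integrable setT (EFin \o (fun t => trunc K (V t) ^+ 2)).
  apply: (ibnd (fun x => trunc K x ^+ 2) (K%:R ^+ 2)); first exact: measurable_funX.
  by move=> x; rewrite normrX lerXn2r ?nnegrE.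
have var : \int[P]_t (z (X t) ^+ 2) <= \int[P]_t (trunc K (X t) ^+ 2).
  have -> : \int[P]_t (z (X t) ^+ 2) =
      \int[P]_t (trunc K (X t) ^+ 2 - (2 * mean K * trunc K (X t) - mean K ^+ 2)).
    by apply: eq_Rintegral => t _; rewrite /z; ring.
  have icst c : P.-integrable setT (EFin \o (fun _ : T => c : R)).
    exact: (bounded_integrable _ `|c|).
  have i2 : P.-integrable setT (EFin \o (fun t => 2 * mean K * trunc K (X t))).
    apply: (ibnd (fun x => 2 * mean K * trunc K x) (`|2 * mean K| * K%:R)).
      by apply: measurable_funM.
    by move=> x; rewrite normrM ler_wpM2l.
  rewrite RintegralB//; last first.
    apply: (ibnd (fun x => 2 * mean K * trunc K x - mean K ^+ 2)
        (`|2 * mean K| * K%:R + `|mean K ^+ 2|)).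
      by apply: measurable_funB => //; apply: measurable_funM.
    by move=> x; rewrite (le_trans (ler_normB _ _))// lerD2r normrM ler_wpM2l.
  rewrite RintegralB// RintegralZl// Rintegral_probability_cst gerBl.
  have -> : 2 * mean K * \int[P]_t trunc K (X t) - mean K ^+ 2 = mean K ^+ 2.
    by rewrite -/(mean K); ring.
  exact: sqr_ge0.
have devE t : dev K t = K%:R^-1 ^+ 2 * (\sum_(i < K) z (Xs i t)) ^+ 2
    + \sum_(i < K) excess K (Xs i t).
  rewrite /dev -exprMn; congr (_ ^+ 2 + _).
  by rewrite /z sumrB sumr_const card_ord mulrBr -[mean K *+ K]mulr_natl mulKf.
under eq_Rintegral do rewrite devE.
have isum : P.-integrable setT (EFin \o (fun t => (\sum_(i < K) z (Xs i t)) ^+ 2)).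
  apply: (bounded_integrable _ ((K%:R * K%:R) ^+ 2)).
    by apply: measurable_funX; apply: measurable_sum => i; exact: mcomp.
  move=> t; rewrite normrX lerXn2r ?nnegrE ?mulr_ge0//.
  apply: (le_trans (ler_norm_sum _ _ _)).
  apply: (@le_trans _ _ (\sum_(i < K) K%:R)); first exact: ler_sum.
  by rewrite sumr_const card_ord mulr_natl.
have iex : P.-integrable setT (EFin \o (fun t => \sum_(i < K) excess K (Xs i t))).
  rewrite (_ : _ \o _ = fun t => \sum_(j < K) (excess K (Xs j t))%:E)%E.
    by apply: integrable_sum => // i _; exact: iexcess.
  by apply/funext => t; rewrite /= sumEFin.
rewrite RintegralD//; last exact: integrable_scale.
rewrite RintegralZl// (Rintegral_sqr_centered_sum z K%:R)//.
rewrite (Rintegral_sum _ _ (fun (i : 'I_K) t => excess K (Xs i t)))//.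
under eq_bigr do rewrite Rintegral_Xs//.
rewrite sumr_const card_ord -[X in _ + X <= _]mulr_natl.
apply: (@le_trans _ _ (K%:R^-1 * \int[P]_t (trunc K (X t) ^+ 2)
   + K%:R * \int[P]_t excess K (X t))).
  rewrite lerD2r mulrA expr2 divfK ?mulfVK// -?mulrA ?mulVf// ?mulr1 ler_wpM2l//.
rewrite -!RintegralZl// -RintegralD//; [|exact: integrable_scale..].
by under eq_Rintegral do rewrite addrC psiE//.
Qed.

Let idev K : P.-integrable setT (EFin \o dev K).
Proof.
(* For [K = 0] the sums are empty and [dev] is constant; [point] merely names an argument. *)
have [->|K0] := posnP K.
  apply: (bounded_integrable _ `|dev 0 point|) => // t.
  by rewrite /dev !big_ord0.
have KR : 0 < K%:R :> R by rewrite ltr0n.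
apply: (bounded_integrable _ (K%:R ^+ 2 + K%:R)) => // t.
rewrite ger0_norm// lerD//.
  rewrite -[leLHS]ger0_norm ?sqr_ge0// normrX lerXn2r ?nnegrE//.
  have /andP[m0 mK] := mean_bnd K.
  have s0 : 0 <= K%:R^-1 * \sum_(i < K) trunc K (Xs i t).
    by rewrite mulr_ge0 ?invr_ge0 ?(ltW KR)// sumr_ge0.
  have sK : K%:R^-1 * \sum_(i < K) trunc K (Xs i t) <= K%:R.
    rewrite ler_pdivrMl//; apply: (@le_trans _ _ (\sum_(i < K) K%:R)).
      exact: ler_sum.
    by rewrite sumr_const card_ord mulr_natl.
  rewrite ler_norml; lra.
apply: (@le_trans _ _ (\sum_(i < K) 1)).
  apply: ler_sum => i _; rewrite excessE.
  by rewrite -[leRHS](mulr1n 1) ler_nat leq_b1.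
by rewrite sumr_const card_ord.
Qed.

Let ipsi K : P.-integrable setT (EFin \o (fun t => psi K (X t))).
Proof.
apply: (ibnd (psi K) K%:R) => // x; rewrite ger0_norm ?ge_min ?lexx//.
by rewrite le_min ler0n divr_ge0 ?sqr_ge0.
Qed.

Lemma cvg_mean_trunc (k : nat -> nat) : (forall n, (n <= k n)%N) ->
  mean (k n) @[n --> \oo] --> \int[P]_t phi (X t).
Proof.
move=> kn; apply: (cvg_Rintegral _ _ (fun t => phi (X t))) => //.
- by move=> n; exact: mcomp.
- exact: mcomp.
- move=> t; apply: cvg_near_cst.
  exists (Num.truncn (phi (X t))).+1 => // n /= Mn.
  rewrite truncE ifT//; apply: (@le_trans _ _ n%:R); last by rewrite ler_nat.
  by rewrite ltW// (lt_le_trans (truncnS_gt _))// ler_nat.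
- move=> n t; rewrite ger0_norm// truncE; case: ifP => //.
Qed.

(** By [sum_min_geometric_le] the expectations of [dev] are summable along the lacunary levels, so
    [dev] tends to 0 almost surely, and the truncated means share the limit of their
    expectations. *)
Lemma strong_law_lacunary m : (0 < m)%N ->
  {ae P, forall t, (\sum_(i < lacunary m n) phi (Xs i t)) / (lacunary m n)%:R
     @[n --> \oo] --> \int[P]_t phi (X t)}.
Proof.
move=> m0; pose k := lacunary m.
have k0 n : (0 < k n)%N by apply: leq_trans (lacunary_ge m n).
pose al : R := 1 + (2 * m%:R)^-1.
have al1 : 1 < al by rewrite ltrDl invr_gt0 mulr_gt0// ltr0n.
pose C := 2 * (1 + al) / (al - 1).
have : {ae P, forall t, dev (k n) t @[n --> \oo] --> 0}.
  apply: (ae_cvg0_sum_integral _ (C * \int[P]_t phi (X t))).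
  - by move=> n; exact: mdev.
  - by move=> n t; exact: dev_ge0.
  move=> N.
  have -> : (\sum_(n < N) \int[P]_t (dev (k n) t)%:E)%E =
      (\sum_(n < N) \int[P]_t dev (k n) t)%:E.
    rewrite -sumEFin; apply: eq_bigr => n _; rewrite /Rintegral fineK//.
    exact: integrable_fin_num (idev _).
  rewrite lee_fin; apply: (@le_trans _ _ (\sum_(n < N) \int[P]_t psi (k n) (X t))).
    by apply: ler_sum => n _; exact: integral_dev.
  rewrite -(Rintegral_sum _ _ (fun (n : 'I_N) t => psi (k n) (X t)))// -RintegralZl//.
  apply: le_Rintegral => //.
  - rewrite (_ : _ \o _ = fun t => \sum_(n < N) (psi (k n) (X t))%:E)%E.
      by apply: integrable_sum => // n _; exact: ipsi.
    by apply/funext => t; rewrite /= sumEFin.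
  - exact: integrable_scale.
  - move=> t _; apply: (sum_min_geometric_le al (phi (X t)) (fun n => (k n)%:R)) => //.
      by move=> n; rewrite ltr0n.
    by move=> n; exact: lacunaryS_ge.
apply: filterS => t dev0.
have sqr0 : (((k n)%:R^-1 * \sum_(i < k n) trunc (k n) (Xs i t) - mean (k n)) ^+ 2)
    @[n --> \oo] --> 0.
  apply: (squeeze_cvgr _ (cvg_cst 0) dev0); apply: nearW => n.
  by rewrite sqr_ge0 lerDl sumr_ge0// => i _; rewrite excessE ler0n.
have avg : ((k n)%:R^-1 * \sum_(i < k n) trunc (k n) (Xs i t)) @[n --> \oo] -->
    \int[P]_t phi (X t).
  rewrite -[X in _ --> X]add0r.
  under eq_fun => n do
    rewrite -(subrK (mean (k n)) ((k n)%:R^-1 * \sum_(i < k n) trunc (k n) (Xs i t))).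
  apply: cvgD; last first.
    by apply: cvg_mean_trunc => n; exact: lacunary_geq_id.
  apply/cvgr0Pnorm_lt => e e0.
  have /cvgr0Pnorm_lt/(_ (e ^+ 2) (exprn_gt0 2 e0)) := sqr0.
  apply: filterS => n; rewrite normrX ltr_pXn2r// ?nnegrE//; exact: ltW.
apply: cvg_trans avg; apply: near_eq_cvg.
(* A single exceedance contributes 1 to [dev]. Once [dev] is below 1 there is none, and truncation
   leaves the sum unchanged. *)
have /cvgr0Pnorm_lt/(_ 1 ltr01) := dev0; apply: filterS => n dn.
rewrite mulrC; congr (_ * _); apply: eq_bigr => i _; rewrite truncE ifT//.
rewrite leNgt; apply/negP => h; move: dn; rewrite ger0_norm//.
apply/negP; rewrite -leNgt /dev [X in _ <= _ + X](bigD1 i)//= excessE h.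
apply: (le_trans _ (_ : 0 + (1 + 0) <= _)); first by rewrite add0r addr0.
rewrite lerD ?sqr_ge0// lerD// sumr_ge0// => j _; rewrite excessE ler0n//.
Qed.

(** Countably many parameters [m] give one almost sure event on which all lacunary averages
    converge; the partial sums are monotone since [phi] is nonnegative. *)
Lemma strong_law_ge0 :
  {ae P, forall t, (\sum_(i < n) phi (Xs i t)) / n%:R @[n --> \oo] -->
     \int[P]_t phi (X t)}.
Proof.
have h m : {ae P, forall t, (\sum_(i < lacunary m.+1 n) phi (Xs i t)) /
    (lacunary m.+1 n)%:R @[n --> \oo] --> \int[P]_t phi (X t)}.
  exact: strong_law_lacunary.
have := ae_foralln h; apply: filterS => t ht.
apply: (cvg_average_lacunary (fun n => \sum_(i < n) phi (Xs i t))).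
- by move=> n; exact: sumr_ge0.
- apply/nondecreasing_seqP => n; rewrite big_ord_recr/= lerDl//.
- by case=> // m _; exact: ht.
Qed.

End nonnegative.

Lemma strong_law (phi : R -> R) : measurable_fun setT phi ->
  P.-integrable setT (EFin \o (fun t => phi (X t))) ->
  {ae P, forall t, n%:R^-1 * \sum_(i < n) phi (Xs i t) @[n --> \oo] -->
     \int[P]_t phi (X t)}.
Proof.
move=> mphi iphi.
pose pos x := Num.max (phi x) 0; pose neg x := Num.max (- phi x) 0.
have mpos : measurable_fun setT pos by apply: measurable_maxr.
have mneg : measurable_fun setT neg.
  by apply: measurable_maxr => //; exact: measurableT_comp.
have pos0 x : 0 <= pos x by rewrite le_max lexx orbT.
have neg0 x : 0 <= neg x by rewrite le_max lexx orbT.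
have phiE x : phi x = pos x - neg x.
  rewrite /pos /neg; have [h|h] := lerP 0 (phi x).
    by rewrite (max_idPr _) ?oppr_le0// subr0.
  by rewrite (max_idPl _) ?oppr_ge0 ?(ltW h)// opprK add0r.
have inorm : P.-integrable setT (EFin \o (fun t => `|phi (X t)|)).
  exact: integrable_norm.
have ipos : P.-integrable setT (EFin \o (fun t => pos (X t))).
  apply: integrable_dominated inorm _; first exact: mcomp.
  by move=> t; rewrite ger0_norm// ge_max ler_norm normr_ge0.
have ineg : P.-integrable setT (EFin \o (fun t => neg (X t))).
  apply: integrable_dominated inorm _; first exact: mcomp.
  by move=> t; rewrite ger0_norm// ge_max -normrN ler_norm normr_ge0.
have := strong_law_ge0 neg mneg neg0 ineg.
have := strong_law_ge0 pos mpos pos0 ipos.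
apply: filterS2 => t cpos cneg.
under eq_Rintegral do rewrite phiE.
rewrite RintegralB//.
apply: cvg_trans (cvgB cpos cneg); apply: near_eq_cvg.
apply: nearW => n; rewrite fctE -mulrBl mulrC -sumrB; congr (_ * _).
by apply: eq_bigr => i _; rewrite phiE.
Qed.

End strong_law.

(** * Pearson moment equations *)

Section fourth_moment.
Context {d : measure_display} {T : measurableType d} {R : realType}.
Context {P : probability T R}.
Variables (X : {RV P >-> R}) (mu : R).
Hypothesis EX : ('E_P[X] = mu%:E)%E.
Hypothesis EX4 : ('E_P[fun t => (X t ^+ 4)%R] < +oo)%E.

(** A common majorant: it dominates the distance to [mu] from any point of modulus at most |x|,
    truncations included, and being at least 1 it has all its lower powers below the fourth. *)
Let b (x : R) := `|x| + `|mu| + 1.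

Let b_ge1 x : 1 <= b x.
Proof. by rewrite /b lerDr addr_ge0. Qed.

Let b_ge0 x : 0 <= b x.
Proof. exact: le_trans (b_ge1 x). Qed.

Let b_dist (x y : R) : `|y| <= `|x| -> `|y - mu| <= b x.
Proof.
by move=> yx; rewrite (le_trans (ler_normB _ _))// /b -addrA lerD// lerDl.
Qed.

Let mb : measurable_fun setT b.
Proof. by do 2?apply: measurable_funD => //; exact: measurable_normr. Qed.

Let mcomp (f : R -> R) : measurable_fun setT f ->
  measurable_fun setT (fun t => f (X t)).
Proof. by move=> mf; exact: measurableT_comp. Qed.

Let ib4 : P.-integrable setT (EFin \o (fun t => b (X t) ^+ 4)).
Proof.
have iX4 : P.-integrable setT (EFin \o (fun t => X t ^+ 4)).
  apply/integrableP; split.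
    apply/measurable_EFinP; exact: measurable_funX.
  under eq_integral do rewrite gee0_abs ?lee_fin ?exprn_even_ge0//.
  by move: EX4; rewrite unlock.
have ic : P.-integrable setT (EFin \o (fun t : T => (`|mu| + 1) ^+ 4)).
  exact: (bounded_integrable _ `|(`|mu| + 1) ^+ 4|).
(* The domination rests on (u + v)^4 <= 8 (u^4 + v^4), proved at the end by exhibiting the
   difference as (u - v)^2 times a form with nonnegative coefficients. *)
have i8 : P.-integrable setT (EFin \o (fun t => 8 * (X t ^+ 4 + (`|mu| + 1) ^+ 4))).
  apply: integrable_scale.
  exact: (integrableD measurableT iX4 ic).
apply: integrable_dominated i8 _.
  by apply: measurable_funX; exact: mcomp.
move=> t; rewrite ger0_norm ?exprn_ge0// /b -addrA.
have -> : X t ^+ 4 = `|X t| ^+ 4 by rewrite -normrX ger0_norm// exprn_even_ge0.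
have u0 := normr_ge0 (X t); have v0 : 0 <= `|mu| + 1 by rewrite addr_ge0.
set u := `|X t| in u0 *; set v := `|mu| + 1 in v0 *.
rewrite -subr_ge0.
have -> : 8 * (u ^+ 4 + v ^+ 4) - (u + v) ^+ 4 =
  (u - v) ^+ 2 * (7 * u ^+ 2 + 10 * (u * v) + 7 * v ^+ 2) by ring.
rewrite mulr_ge0 ?sqr_ge0// addr_ge0//; last by rewrite mulr_ge0// sqr_ge0.
by rewrite addr_ge0// mulr_ge0// ?sqr_ge0// mulr_ge0.
Qed.

Lemma integrable_fourth (f : R -> R) (c : R) : measurable_fun setT f ->
  (forall x, `|f x| <= c * (`|x| + `|mu| + 1) ^+ 4) ->
  P.-integrable setT (EFin \o (fun t => f (X t))).
Proof.
move=> mf fc.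
apply: (integrable_dominated _ (fun t => c * b (X t) ^+ 4)).
- exact: mcomp.
- exact: integrable_scale.
- by move=> t; exact: fc.
Qed.

Lemma integrable_centered_power k : (k <= 4)%N ->
  P.-integrable setT (EFin \o (fun t => (X t - mu) ^+ k)).
Proof.
move=> k4; apply: (integrable_fourth (fun x => (x - mu) ^+ k) 1).
  by apply: measurable_funX; exact: measurable_funB.
move=> x; rewrite mul1r normrX (@le_trans _ _ (b x ^+ k))//.
  by rewrite lerXn2r ?nnegrE//; exact: b_dist.
exact: ler_weXn2l.
Qed.

Lemma Rintegral_RV : \int[P]_t X t = mu.
Proof. by rewrite /Rintegral; move: EX; rewrite unlock => ->. Qed.

Lemma integrable_RV : P.-integrable setT (EFin \o X).
Proof.
apply: (integrable_fourth id 1) => // x; rewrite mul1r.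
apply: (@le_trans _ _ (b x ^+ 1)); last exact: ler_weXn2l.
by rewrite expr1 /b -addrA lerDl addr_ge0.
Qed.

Lemma cmomentE k : cmoment X mu k = \int[P]_t ((X t - mu) ^+ k).
Proof. by rewrite /cmoment unlock. Qed.

Lemma cmoment1 : cmoment X mu 1 = 0.
Proof.
rewrite cmomentE; under eq_Rintegral do rewrite expr1.
have ic : P.-integrable setT (EFin \o (fun t : T => mu)).
  exact: (bounded_integrable _ `|mu|).
by rewrite RintegralB// ?Rintegral_RV ?Rintegral_probability_cst ?subrr//; exact: integrable_RV.
Qed.

(** The coefficient [a1] disappears because the first central moment is 0. *)
Lemma Rintegral_quartic (a0 a1 a2 a3 a4 : R) :
  \int[P]_t (a0 + a1 * (X t - mu) + a2 * (X t - mu) ^+ 2 + a3 * (X t - mu) ^+ 3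
             + a4 * (X t - mu) ^+ 4) =
  a0 + a2 * cmoment X mu 2 + a3 * cmoment X mu 3 + a4 * cmoment X mu 4.
Proof.
pose a := [:: a0; a1; a2; a3; a4].
transitivity (\int[P]_t (\sum_(i < 5) a`_i * (X t - mu) ^+ i)).
  apply: eq_Rintegral => t _; rewrite !big_ord_recr big_ord0/=.
  by rewrite expr0 expr1 mulr1 add0r.
have ii (i : 'I_5) : P.-integrable setT
    (EFin \o (fun t => a`_i * (X t - mu) ^+ i)).
  by apply: integrable_scale; apply: integrable_centered_power; rewrite -ltnS.
rewrite (Rintegral_sum _ _ (fun (i : 'I_5) t => a`_i * (X t - mu) ^+ i))//.
rewrite !big_ord_recr big_ord0/= !RintegralZl//;
  try exact: integrable_centered_power.
rewrite -!cmomentE cmoment1 mulr0 addr0 add0r; congr (_ + _ + _ + _).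
rewrite cmomentE; under eq_Rintegral do rewrite expr0.
by rewrite Rintegral_probability_cst mulr1.
Qed.

Section truncated_covariance.
Variables (q h : R -> R) (cq ch : R) (k : nat).
Hypothesis mq : measurable_fun setT q.
Hypothesis mh : measurable_fun setT h.
Hypothesis qc : forall x, `|q x| <= cq * (`|x| + `|mu| + 1) ^+ 2.
Hypothesis hc : forall x, `|h x| <= ch * (`|x| + `|mu| + 1) ^+ 2.
Hypothesis k3 : (k <= 3)%N.

(** Composing a function with [clamp], rather than cutting it off by an indicator, keeps its
    increments on [-n, n) and removes those outside without creating a jump. *)
Definition clamp (n : nat) (x : R) : R := Num.min n%:R (Num.max (- n%:R) x).

Lemma clamp_norm n x : `|clamp n x| <= `|x|.
Proof.
have n0 : 0 <= n%:R :> R by [].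
rewrite /clamp; have [xn|nx] := lerP n%:R (Num.max (- n%:R) x).
  move: xn; rewrite le_max => /orP[n0'|xn]; last by rewrite ger0_norm// (le_trans xn)// ler_norm.
  by rewrite (_ : n%:R = 0) ?normr0//; lra.
have [xn|xn] := lerP x (- n%:R); last by [].
by rewrite normrN ger0_norm// -normrN (le_trans _ (ler_norm _))//; lra.
Qed.

Lemma measurable_clamp n : measurable_fun setT (clamp n).
Proof. by apply: measurable_minr => //; exact: measurable_maxr. Qed.

Lemma clamp_id n x : `|x| <= n%:R -> clamp n x = x.
Proof.
rewrite ler_norml => /andP[h1 h2].
by rewrite /clamp (max_idPr h1) (min_idPr h2).
Qed.

Let mqh : measurable_fun setT (fun x => q x * h x).
Proof. exact: measurable_funM. Qed.

Let qhc x : `|q x * h x| <= cq * ch * b x ^+ 4.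
Proof.
rewrite normrM; apply: (@le_trans _ _ ((cq * b x ^+ 2) * (ch * b x ^+ 2))).
  exact: ler_pM.
by rewrite (_ : _ * _ = cq * ch * b x ^+ 4)//; ring.
Qed.

(** Both sides pass to the limit by dominated convergence: the left one under |q h|, the right one
    under the fourth power of [b], as [k.+1] is at most 4. *)
Lemma covariance_of_truncations :
  (forall n : nat,
    \int[P]_t (q (X t) * h (X t) * \1_(`[- n%:R, n%:R[%classic) (X t)) =
    \int[P]_t ((mu - X t) * ((n%:R - mu) ^+ k - (clamp n (X t) - mu) ^+ k))) ->
  \int[P]_t (q (X t) * h (X t)) = cmoment X mu k.+1.
Proof.
move=> trunc; rewrite cmomentE.
have iqh := integrable_fourth _ _ mqh qhc.
have b4X := ib4.
have mg n : measurable_fun setT (fun x : R => (clamp n x - mu) ^+ k).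
  by apply: measurable_funX; apply: measurable_funB => //; exact: measurable_clamp.
have mG n : measurable_fun setT (fun x : R => (x - mu) * (clamp n x - mu) ^+ k).
  by apply: measurable_funM => //; exact: measurable_funB.
have Gb n (x : R) : `|(x - mu) * (clamp n x - mu) ^+ k| <= 1 * b x ^+ 4.
  rewrite mul1r normrM normrX; apply: (@le_trans _ _ (b x * b x ^+ k)).
    by rewrite ler_pM ?exprn_ge0 ?b_dist// lerXn2r ?nnegrE// b_dist// clamp_norm.
  by rewrite -exprS ler_weXn2l.
pose ind n : R -> R := \1_(`[- n%:R, n%:R[%classic).
have mind n : measurable_fun setT (ind n) by exact: measurable_indic.
have l1 : \int[P]_t (q (X t) * h (X t) * ind n (X t)) @[n --> \oo] -->
    \int[P]_t (q (X t) * h (X t)).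
  apply: (cvg_Rintegral _ _ (fun t => `|q (X t) * h (X t)|)).
  - move=> n; apply: (mcomp (fun x => q x * h x * ind n x)).
    exact: measurable_funM.
  - exact: (mcomp (fun x => q x * h x)).
  - exact: integrable_norm.
  - move=> t; apply: cvg_near_cst.
    exists (Num.truncn `|X t|).+1 => // n /= Mn.
    rewrite /ind indicE mem_set ?mulr1//= in_itv/=.
    have : `|X t| < n%:R by rewrite (lt_le_trans (truncnS_gt _))// ler_nat.
    by rewrite ltr_norml => /andP[/ltW-> ->].
  - move=> n t; rewrite normrM ler_piMr// /ind indicE ger0_norm ?ler0n//.
    by rewrite -[leRHS](mulr1n 1) ler_nat leq_b1.
have l2 : \int[P]_t ((X t - mu) * (clamp n (X t) - mu) ^+ k) @[n --> \oo] -->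
    \int[P]_t ((X t - mu) ^+ k.+1).
  apply: (cvg_Rintegral _ _ (fun t => 1 * b (X t) ^+ 4)).
  - by move=> n; exact: (mcomp (fun x => (x - mu) * (clamp n x - mu) ^+ k)).
  - apply: (mcomp (fun x => (x - mu) ^+ k.+1)).
    by apply: measurable_funX; exact: measurable_funB.
  - exact: integrable_scale.
  - move=> t; apply: cvg_near_cst.
    exists (Num.truncn `|X t|).+1 => // n /= Mn.
    rewrite clamp_id ?exprS// ltW// (lt_le_trans (truncnS_gt _))// ler_nat//.
  - by move=> n t; exact: Gb.
have icent : P.-integrable setT (EFin \o (fun t => X t - mu)).
  by have := integrable_centered_power 1 isT; under eq_fun do rewrite expr1.
have c0 : \int[P]_t (X t - mu) = 0.
  by rewrite -cmoment1 cmomentE; apply: eq_Rintegral => t _; rewrite expr1.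
apply: (cvg_unique _ l1 (cvg_trans _ l2)) => //; apply: near_eq_cvg.
apply: nearW => n; rewrite /ind trunc.
(* The boundary value (n - mu)^k multiplies E[mu - X] = 0 and drops out. *)
under [RHS]eq_Rintegral => t _.
  rewrite (_ : _ * _ = (X t - mu) * (clamp n (X t) - mu) ^+ k -
    (n%:R - mu) ^+ k * (X t - mu)); last by ring.
  over.
rewrite RintegralB//; last exact: integrable_scale.
  by rewrite RintegralZl// c0 mulr0 subr0.
exact: (integrable_fourth (fun x => (x - mu) * (clamp n x - mu) ^+ k) 1).
Qed.

End truncated_covariance.

Lemma pearson_q_bound (c2 c1 c0 x : R) :
  `|pearson_q c2 c1 c0 mu x| <=
    (`|c2| + `|c1| + `|c0|) * (`|x| + `|mu| + 1) ^+ 2.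
Proof.
have y1 := b_dist x x (lexx _); have b1 := b_ge1 x; rewrite -/(b x).
have b2 : 1 <= b x ^+ 2 by rewrite exprn_ege1.
have bb : b x <= b x ^+ 2 by rewrite expr2 ler_peMl.
rewrite /pearson_q !mulrDl (le_trans (ler_normD _ _))// lerD//; last first.
  exact: ler_peMr.
rewrite (le_trans (ler_normD _ _))// lerD// normrM ler_wpM2l//.
  by rewrite normrX lerXn2r ?nnegrE.
exact: le_trans bb.
Qed.

Lemma measurable_pearson_q (c2 c1 c0 : R) :
  measurable_fun setT (pearson_q c2 c1 c0 mu).
Proof.
have mx : measurable_fun setT (fun x : R => x - mu) by exact: measurable_funB.
apply: measurable_funD => //; apply: measurable_funD; apply: measurable_funM => //.
exact: measurable_funX.
Qed.

(* The covariance identity E[q(X) h(X)] = E[(X - mu) ^+ k.+1] spelled out for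
   h = pearson_q c2 c1 c0 mu, h being the difference or derivative of
   (x - mu) ^+ k. *)
Lemma pearson_moment_equation (dl bt gm c2 c1 c0 : R) (k : nat) : (k <= 3)%N ->
  (forall n : nat,
    \int[P]_t (pearson_q dl bt gm mu (X t) * pearson_q c2 c1 c0 mu (X t) *
      \1_(`[- n%:R, n%:R[%classic) (X t)) =
    \int[P]_t ((mu - X t) * ((n%:R - mu) ^+ k - (clamp n (X t) - mu) ^+ k))) ->
  gm * c0 + (dl * c0 + bt * c1 + gm * c2) * cmoment X mu 2
    + (dl * c1 + bt * c2) * cmoment X mu 3 + dl * c2 * cmoment X mu 4
  = cmoment X mu k.+1.
Proof.
move=> k3 /(covariance_of_truncations _ _ _ _ _ (measurable_pearson_q dl bt gm)
  (measurable_pearson_q c2 c1 c0) (pearson_q_bound dl bt gm)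
  (pearson_q_bound c2 c1 c0) k3) <-.
(* The coefficient of X - mu in the product, absent from the moment formula, has to be supplied. *)
rewrite -(Rintegral_quartic _ (gm * c1 + bt * c0)).
by apply: eq_Rintegral => t _; rewrite /pearson_q; ring.
Qed.

End fourth_moment.

(** * Integer-valued case: summation by parts *)

Section discrete.
Context {d : measure_display} {T : measurableType d} {R : realType}.
Context {P : probability T R}.
Variables (X : {RV P >-> R}) (mu dl bt gm : R).
Hypothesis intX : forall t, X t \is a Num.int.
Hypothesis EX : ('E_P[X] = mu%:E)%E.
Hypothesis EX4 : ('E_P[fun t => (X t ^+ 4)%R] < +oo)%E.
Hypothesis pearsonX :
  pearson_discrete (fun j : int => pmf X j%:~R) dl bt gm mu.

Let icent : P.-integrable setT (EFin \o (fun t => mu - X t)).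
Proof.
have ic : P.-integrable setT (EFin \o (fun t : T => mu)).
  exact: (bounded_integrable _ `|mu|).
exact: (integrableB measurableT ic (integrable_RV X mu EX4)).
Qed.

Let mind (A : set R) : measurable A ->
  measurable_fun setT (fun t => \1_A (X t) : R).
Proof. by move=> mA; apply: measurableT_comp => //; exact: measurable_indic. Qed.

Let ind01 (A : set R) (x : R) : 0 <= (\1_A x : R) <= 1.
Proof. by rewrite indicE ler0n -[leRHS](mulr1n 1) ler_nat leq_b1. Qed.

Let icent_ind (A : set R) : measurable A ->
  P.-integrable setT (EFin \o (fun t => (mu - X t) * \1_A (X t))).
Proof.
move=> mA; apply: (integrable_dominated _ (fun t => `|mu - X t|)).
- by apply: measurable_funM; [exact: measurable_funB|exact: mind].
- exact: integrable_norm.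
- move=> t; have /andP[i0 i1] := ind01 A (X t).
  by rewrite normrM ler_piMr// ger0_norm.
Qed.

Lemma Rintegral_atom (phi : R -> R) (a : R) :
  \int[P]_t (phi (X t) * \1_[set a] (X t)) = phi a * pmf X a.
Proof.
transitivity (\int[P]_t (phi a * \1_(X @^-1` [set a]) t)).
  apply: eq_Rintegral => t _; rewrite !indicE.
  have [Xa|Xa] := boolP (t \in X @^-1` [set a]).
    by move: Xa; rewrite inE/= => ->; rewrite mem_set.
  by rewrite memNset ?mulr0// => Xat; move: Xa; rewrite notin_setE; apply.
have mXa : measurable (X @^-1` [set a]) by exact: measurable_funPTI.
rewrite RintegralZl//; last by apply: integrable_indic => //; rewrite fin_num_measure.
by rewrite /Rintegral integral_indic// setIT.
Qed.

Let iatom (phi : R -> R) (a : R) :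
  P.-integrable setT (EFin \o (fun t => phi (X t) * \1_[set a] (X t))).
Proof.
rewrite (_ : (fun t => _) = (fun t => phi a * \1_[set a] (X t))).
  apply: integrable_scale; apply: (bounded_integrable _ 1).
    exact: mind.
  by move=> t; have /andP[i0 i1] := ind01 [set a] (X t); rewrite ger0_norm.
apply/funext => t; rewrite indicE.
have [Xa|Xa] := eqVneq (X t) a; first by rewrite Xa.
by rewrite memNset ?mulr0//=; exact/eqP.
Qed.

(** The atoms j, j - 1, ..., j - N + 1 are exactly the integers of ]j - N, j]. *)
Lemma sum_indic_atoms (z j : int) N :
  \sum_(i < N) \1_[set ((j - i%:Z)%:~R : R)] (z%:~R : R) = (
  \1_(`]((j - N%:Z)%:~R : R), (j%:~R : R)]%classic) (z%:~R : R) : R).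
Proof.
elim: N => [|N ih].
  rewrite big_ord0 indicE mem_setE in_itv/= ltr_int ler_int subr0.
  by rewrite (_ : (_ && _) = false)//; apply/negbTE; lia.
rewrite big_ord_recr/= ih !indicE !mem_setE !in_itv/= in_set1 eqr_int.
by rewrite !ltr_int !ler_int -natrD; congr (_%:R); lia.
Qed.

(** The partial sums of the Pearson series are expectations restricted to ]j - N, j]; dominated
    convergence with majorant |mu - X| identifies their limit. *)
Lemma pearson_discrete_cumulative (j : int) :
  pearson_q dl bt gm mu j%:~R * pmf X j%:~R =
  \int[P]_t ((mu - X t) * \1_(`]-oo, (j%:~R : R)]%classic) (X t)).
Proof.
apply: (cvg_unique _ (pearsonX j)) => //.
have -> : (fun N : nat => \sum_(0 <= i < N) (mu - (j - i%:Z)%:~R) *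
    pmf X (j - i%:Z)%:~R) =
  (fun N : nat => \int[P]_t ((mu - X t) *
      \1_(`]((j - N%:Z)%:~R : R), (j%:~R : R)]%classic) (X t))).
  apply/funext => N; rewrite big_mkord.
  under eq_bigr do rewrite -(Rintegral_atom (fun x => mu - x)).
  rewrite -(Rintegral_sum _ _ (fun (i : 'I_N) t => (mu - X t) *
    \1_[set ((j - i%:Z)%:~R : R)] (X t))); last first.
    by move=> i; exact: (iatom (fun x => mu - x)).
  apply: eq_Rintegral => t _; have /intrP[z ->] := intX t.
  by rewrite -sum_indic_atoms mulr_sumr.
apply: (cvg_Rintegral _ _ (fun t => `|mu - X t|)).
- by move=> N; apply: measurable_funM; [exact: measurable_funB|exact: mind].
- by apply: measurable_funM; [exact: measurable_funB|exact: mind].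
- exact: integrable_norm.
- move=> t; have /intrP[z ->] := intX t; apply: cvg_near_cst.
  exists `|j - z|.+1%N => // N /= jzN; congr (_ * _).
  rewrite !indicE !mem_setE !in_itv/= ltr_int ler_int; congr (_%:R).
  by congr (nat_of_bool _); lia.
- move=> N t; have /andP[i0 i1] := ind01 `]((j - N%:Z)%:~R : R), (j%:~R : R)]%classic (X t).
  by rewrite normrM ler_piMr// ger0_norm.
Qed.

Lemma sum_differences_clamp (g : R -> R) (z : int) (n : nat) :
  \sum_(i < n + n) (g (n%:R - i%:R) - g ((n%:Z - 1 - i%:Z)%:~R)) *
     \1_(`]-oo, ((n%:Z - 1 - i%:Z)%:~R : R)]%classic) (z%:~R : R) =
  g n%:R - g (clamp n z%:~R).
Proof.
(* The levels are taken downwards from n - 1. After N of them the argument is cut below at n - N,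
   and N = 2n gives the two-sided clamp. *)
have H N : \sum_(i < N) (g (n%:R - i%:R) - g ((n%:Z - 1 - i%:Z)%:~R)) *
     \1_(`]-oo, ((n%:Z - 1 - i%:Z)%:~R : R)]%classic) (z%:~R : R) =
  g n%:R - g (Num.max (n%:R - N%:R) (Num.min n%:R z%:~R)).
  elim: N => [|N ih].
    by rewrite big_ord0 subr0 (max_idPl _) ?subrr// ge_min lexx.
  rewrite big_ord_recr/= ih indicE mem_setE in_itv/=.
  have e1 : n%:R - N.+1%:R = (n%:Z - 1 - N%:Z)%:~R :> R.
    by rewrite !intrB -!pmulrn -natr1; ring.
  rewrite e1; have [zn|nz] := lerP.
    have e2 : (n%:Z - 1 - N%:Z)%:~R <= n%:R - N%:R :> R.
      by rewrite -e1 lerD2l lerN2 ler_nat.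
    rewrite !(max_idPl _) ?mulr1; first by ring.
    - by rewrite ge_min zn orbT.
    - by rewrite ge_min (le_trans zn e2) orbT.
  have e3 : n%:R - N%:R <= z%:~R :> R.
    rewrite ltr_int in nz.
    have -> : n%:R - N%:R = (n%:Z - N%:Z)%:~R :> R by rewrite intrB -!pmulrn.
    by rewrite ler_int; lia.
  rewrite mulr0 addr0; congr (_ - g _).
  rewrite !(max_idPr _)// le_min ?e3 ?(ltW nz) andbT.
    by rewrite -e1 gerBl.
  by rewrite gerBl.
rewrite H; congr (_ - g _).
rewrite natrD opprD addrA subrr add0r /clamp.
have n0 : - n%:R <= n%:R :> R by rewrite (@le_trans _ _ 0) ?oppr_le0.
have [zn|nz] := lerP n%:R (z%:~R : R).
  by rewrite (max_idPr n0) (max_idPr (le_trans n0 zn)) (min_idPl zn).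
by rewrite (min_idPr _)// ge_max n0 ltW.
Qed.

(** Both sides equal the sum of h(a) E[(mu - X) 1(X <= a)] over the integers a in [-n, n): the left
    one by the Pearson identity at each atom, the right one by telescoping. *)
Lemma discrete_truncation (h : R -> R) (k n : nat) :
  (forall x, (x + 1 - mu) ^+ k - (x - mu) ^+ k = h x) ->
  \int[P]_t (pearson_q dl bt gm mu (X t) * h (X t) *
      \1_(`[- n%:R, n%:R[%classic) (X t)) =
  \int[P]_t ((mu - X t) * ((n%:R - mu) ^+ k - (clamp n (X t) - mu) ^+ k)).
Proof.
move=> hE.
pose a (i : 'I_(n + n)) := (n%:Z - 1 - i%:Z : int).
transitivity (\sum_i h (a i)%:~R *
    \int[P]_t ((mu - X t) * \1_(`]-oo, ((a i)%:~R : R)]%classic) (X t))).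
  under eq_bigr do rewrite -pearson_discrete_cumulative mulrA [h _ * _]mulrC
    -(Rintegral_atom (fun x => pearson_q dl bt gm mu x * h x)).
  rewrite -(Rintegral_sum _ _ (fun (i : 'I_(n + n)) t =>
     pearson_q dl bt gm mu (X t) * h (X t) * \1_[set ((a i)%:~R : R)] (X t))); last first.
    by move=> i; exact: (iatom (fun x => pearson_q dl bt gm mu x * h x)).
  apply: eq_Rintegral => t _; have /intrP[z ->] := intX t.
  rewrite -mulr_sumr sum_indic_atoms; congr (_ * _).
  have -> : - n%:R = (- n%:Z)%:~R :> R by rewrite mulrNz -pmulrn.
  rewrite (pmulrn 1 n) !indicE !mem_setE !in_itv/= !ltr_int !ler_int.
  by congr (_%:R); congr (nat_of_bool _); lia.
under eq_bigr do rewrite -RintegralZl ?icent_ind//.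
rewrite -(Rintegral_sum _ _ (fun (i : 'I_(n + n)) t =>
    h (a i)%:~R * ((mu - X t) * \1_(`]-oo, ((a i)%:~R : R)]%classic) (X t)))); last first.
  by move=> i; apply: integrable_scale; exact: icent_ind.
apply: eq_Rintegral => t _; have /intrP[z ->] := intX t.
rewrite -(sum_differences_clamp (fun x => (x - mu) ^+ k)) mulr_sumr.
apply: eq_bigr => i _; rewrite mulrCA; congr (_ * (_ * _)).
rewrite -hE; congr ((_ - _) ^+ _ - _).
by rewrite /a !intrB -!pmulrn; ring.
Qed.

(** With y = x - mu, the forward differences of y, y^2, y^3 are 1, 2y + 1 and 3y^2 + 3y + 1. The
    first equation then replaces gm + dl mu_2 by mu_2 in the other two. *)
Lemma pearson_discrete_moments :
  [/\ dl * cmoment X mu 2 + gm = cmoment X mu 2,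
      2 * dl * cmoment X mu 3 + 2 * bt * cmoment X mu 2 + cmoment X mu 2
        = cmoment X mu 3 &
      3 * dl * cmoment X mu 4 + 3 * bt * cmoment X mu 3 + 3 * gm * cmoment X mu 2
        + 3 * dl * cmoment X mu 3 + 3 * bt * cmoment X mu 2 + cmoment X mu 2
        = cmoment X mu 4].
Proof.
have eqn := pearson_moment_equation X mu EX EX4 dl bt gm.
have d1 x : (x + 1 - mu) ^+ 1 - (x - mu) ^+ 1 = pearson_q 0 0 1 mu x.
  by rewrite /pearson_q; ring.
have d2 x : (x + 1 - mu) ^+ 2 - (x - mu) ^+ 2 = pearson_q 0 2 1 mu x.
  by rewrite /pearson_q; ring.
have d3 x : (x + 1 - mu) ^+ 3 - (x - mu) ^+ 3 = pearson_q 3 3 1 mu x.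
  by rewrite /pearson_q; ring.
have e1 := eqn 0 0 1 1%N isT (fun n => discrete_truncation _ 1 n d1).
have e2 := eqn 0 2 1 2%N isT (fun n => discrete_truncation _ 2 n d2).
have e3 := eqn 3 3 1 3%N isT (fun n => discrete_truncation _ 3 n d3).
have {}e1 : dl * cmoment X mu 2 + gm = cmoment X mu 2.
  by rewrite -[RHS]e1; ring.
by split; [|lra|lra].
Qed.

End discrete.

(** * Continuous case: integration against the density *)

Section continuous.
Context {d : measure_display} {T : measurableType d} {R : realType}.
Context {P : probability T R}.
Variables (X : {RV P >-> R}) (f : R -> R).
Hypothesis mf : measurable_fun setT f.
Hypothesis f0 : forall x, 0 <= f x.
Hypothesis fX : forall A : set R, measurable A ->
  P (X @^-1` A) = (\int[@lebesgue_measure R]_(x in A) (f x)%:E)%E.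

Local Notation leb := (@lebesgue_measure R).

Lemma density_no_atom x : P (X @^-1` [set x]) = 0%E.
Proof. by rewrite fX// integral_set1. Qed.

(* [lebesgue_measure] lives on [measurableTypeR R], whose display is not the
   one of [R]. *)
Let Y : T -> measurableTypeR R := X.

Let mY : measurable_fun setT Y.
Proof. by move=> _ A mA; exact: (measurable_funPT X). Qed.

HB.instance Definition _ := isMeasurableFun.Build _ _ _ _ Y mY.

Let nu := distribution P (Y : {RV P >-> measurableTypeR R}).

(** The law of [X] is absolutely continuous, and [f] agrees almost everywhere with its Radon-Nikodym
    derivative, both having the same integrals over measurable sets; the change of variables for
    that derivative concludes. *)
Lemma integral_density (phi : R -> R) : measurable_fun setT phi ->
  P.-integrable setT (EFin \o (fun t => phi (X t))) ->
  (\int[P]_t (phi (X t))%:E = \int[leb]_x (phi x * f x)%:E)%E.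
Proof.
move=> mphi iphi.
have mEphi : measurable_fun setT ((EFin \o phi) : measurableTypeR R -> \bar R).
  exact/measurable_EFinP.
have mEf : measurable_fun setT ((EFin \o f) : measurableTypeR R -> \bar R).
  exact/measurable_EFinP.
have numu : nu `<< leb.
  apply/null_content_dominatesP => A mA A0; rewrite /nu [LHS]fX//.
  by apply: null_set_integral => //; exact: measurable_funTS.
have if1 : leb.-integrable setT (EFin \o f).
  apply/integrableP; split => //.
  under eq_integral do rewrite /= ger0_norm//.
  by rewrite -fX// preimage_setT probability_setT ltry.
have rn : ae_eq leb setT (EFin \o f) (Radon_Nikodym (charge_of_finite_measure nu) leb).
  apply: integral_ae_eq => // E _ mE.
  by rewrite -Radon_Nikodym_integral//= -[LHS]fX//.
transitivity (\int[nu]_x (EFin \o phi) x)%E.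
  by rewrite integral_distribution.
rewrite -(Radon_Nikodym_change_of_variables numu measurableT); last first.
  exact: integrable_pushforward.
have mrn : measurable_fun setT (Radon_Nikodym (charge_of_finite_measure nu) leb).
  by apply: (measurable_int leb); exact: Radon_Nikodym_integrable.
under [RHS]eq_integral do rewrite EFinM.
apply: ae_eq_integral => //.
- exact: (emeasurable_funM mEphi mrn).
- exact: (emeasurable_funM mEphi mEf).
- by apply: ae_eqe_mul2l; exact: ae_eq_sym.
Qed.

End continuous.

(** * Continuous case: integration by parts through Fubini *)

Section continuous_pearson.
Context {d : measure_display} {T : measurableType d} {R : realType}.
Context {P : probability T R}.
Variables (X : {RV P >-> R}) (f : R -> R) (mu dl bt gm : R).
Hypothesis mf : measurable_fun setT f.
Hypothesis f0 : forall x, 0 <= f x.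
Hypothesis fX : forall A : set R, measurable A ->
  P (X @^-1` A) = (\int[@lebesgue_measure R]_(x in A) (f x)%:E)%E.
Hypothesis EX : ('E_P[X] = mu%:E)%E.
Hypothesis EX4 : ('E_P[fun t => (X t ^+ 4)%R] < +oo)%E.
Hypothesis pearsonX : pearson_continuous f dl bt gm mu.

Local Notation leb := (@lebesgue_measure R).

Let icent : P.-integrable setT (EFin \o (fun t => mu - X t)).
Proof.
have ic : P.-integrable setT (EFin \o (fun t : T => mu)).
  exact: (bounded_integrable _ `|mu|).
exact: (integrableB measurableT ic (integrable_RV X mu EX4)).
Qed.

Let ind01 (A : set R) (x : R) : 0 <= (\1_A x : R) <= 1.
Proof. by rewrite indicE ler0n -[leRHS](mulr1n 1) ler_nat leq_b1. Qed.

(** The indicator of X <= x, written through the difference x - X so that joint measurability in (x,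
    t) is immediate. *)
Let tail (x : R) (t : T) : R := \1_(`[0, +oo[%classic : set R) (x - X t).

Let icent_tail x : P.-integrable setT (EFin \o (fun t => (mu - X t) * tail x t)).
Proof.
apply: (integrable_dominated _ (fun t => `|mu - X t|)).
- apply: measurable_funM; first exact: measurable_funB.
  apply: measurableT_comp; first exact: measurable_indic.
  exact: measurable_funB.
- exact: integrable_norm.
- move=> t; have /andP[i0 i1] := ind01 `[0, +oo[%classic (x - X t).
  by rewrite normrM ler_piMr// ger0_norm.
Qed.

Lemma pearson_continuous_cumulative x :
  pearson_q dl bt gm mu x * f x = \int[P]_t ((mu - X t) * tail x t).
Proof.
have indE t : (mu - X t) * tail x t =
    (fun y => (mu - y) * \1_(`]-oo, x]%classic : set R) y) (X t).
  rewrite /tail !indicE !mem_setE !in_itv/= andbT subr_ge0//.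
apply: EFin_inj; rewrite -pearsonX /Rintegral fineK; last first.
  exact: (integrable_fin_num measurableT (icent_tail x)).
under [RHS]eq_integral do rewrite indE.
rewrite (integral_density X f mf f0 fX
    (fun y => (mu - y) * \1_(`]-oo, x]%classic : set R) y)); last 2 first.
- apply: measurable_funM; first exact: measurable_funB.
  exact: measurable_indic.
- by have := icent_tail x; under eq_fun do rewrite indE.
rewrite integral_mkcond; apply: eq_integral => y _.
rewrite patchE indicE; case: ifP => _; first by rewrite mulr1.
by rewrite mulr0 mul0r.
Qed.

(** The two indicators cut out [clamp n y, n), where the fundamental theorem of calculus applies. *)
Lemma integral_derivative_clamp (g h : R -> R) (n : nat) (y : R) :
  (forall x : R, is_derive x (1 : R) g (h x)) -> continuous h ->
  (\int[leb]_x (h x * \1_(`[- n%:R, n%:R[%classic : set R) x *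
     \1_(`[0, +oo[%classic : set R) (x - y))%:E = (g n%:R - g (clamp n y))%:E)%E.
Proof.
move=> gh ch; set c := clamp n y.
have cE x : (- n%:R <= x < n%:R) && (0 <= x - y) = (c <= x < n%:R).
  rewrite /c /clamp ge_min ge_max subr_ge0.
  by rewrite ltNge; case: (n%:R <= x); rewrite /= ?andbF ?andbT.
transitivity (\int[leb]_(x in `[c, n%:R[) (h x)%:E)%E.
  rewrite [RHS]integral_mkcond; apply: eq_integral => x _.
  rewrite patchE !indicE !mem_setE !in_itv/= andbT -mulrA -natrM mulnb cE.
  by case: ifP; rewrite ?mulr1 ?mulr0.
have mh : measurable_fun setT h by exact: continuous_measurable_fun.
have cn : c <= n%:R by rewrite ge_min lexx.
(* If [c] is n the interval is empty and both sides are 0. *)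
move: cn; rewrite le_eqVlt => /predU1P[->|cn].
  by rewrite set_itvco0 integral_set0 subrr.
have cg : continuous g.
  by move=> x; apply: differentiable_continuous; apply/derivable1_diffP.
rewrite integral_itv_bndo_bndc; last first.
  by apply/measurable_EFinP; exact: measurable_funTS.
rewrite (@continuous_FTC2 _ h g)// ?EFinB//.
- by move=> x; apply: continuous_subspaceT.
- split => //.
  + by apply: cvg_at_right_filter; exact: cg.
  + by apply: cvg_at_left_filter; exact: cg.
- by move=> x _; rewrite derive1E; exact: derive_val.
Qed.

(** Fubini for the function [F] below: integrating over the sample space first produces q f through
    the Pearson identity, integrating over the line first produces the increment of (x - mu)^k. *)
Lemma continuous_truncation (c2 c1 c0 : R) (k n : nat) :
  (forall x : R, is_derive x (1 : R) (fun x => (x - mu) ^+ k) (pearson_q c2 c1 c0 mu x)) ->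
  \int[P]_t (pearson_q dl bt gm mu (X t) * pearson_q c2 c1 c0 mu (X t) *
      \1_(`[- n%:R, n%:R[%classic) (X t)) =
  \int[P]_t ((mu - X t) * ((n%:R - mu) ^+ k - (clamp n (X t) - mu) ^+ k)).
Proof.
set q := pearson_q dl bt gm mu; set h := pearson_q c2 c1 c0 mu => gh.
have mq : measurable_fun setT q by exact: measurable_pearson_q.
have mh : measurable_fun setT h by exact: measurable_pearson_q.
have ch : continuous h.
  move=> x; rewrite /h /pearson_q.
  have cx : (fun x : R => x - mu) @ x --> x - mu.
    by apply: cvgB; [exact: cvg_id|exact: cvg_cst].
  apply: cvgD; last exact: cvg_cst.
  apply: cvgD; apply: cvgM; [exact: cvg_cst| |exact: cvg_cst|exact: cx].
  exact: (cvgM cx cx).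
pose I : R -> R := \1_(`[- n%:R, n%:R[%classic).
have mI : measurable_fun setT I by exact: measurable_indic.
pose C := (`|c2| + `|c1| + `|c0|) * (n%:R + `|mu| + 1) ^+ 2.
have C0 : 0 <= C by rewrite mulr_ge0 ?addr_ge0// sqr_ge0.
have hI x : `|h x * I x| <= C * I x.
  rewrite normrM /I indicE; have [|_] := boolP (x \in _); last first.
    by rewrite normr0 !mulr0.
  rewrite inE/= in_itv/= => /andP[nx xn]; rewrite normr1 !mulr1.
  apply: (le_trans (pearson_q_bound mu c2 c1 c0 x)).
  rewrite ler_wpM2l ?addr_ge0// lerXn2r ?nnegrE ?addr_ge0//.
  by rewrite !lerD2r ler_norml nx ltW.
have hIC x : `|h x * I x| <= C.
  apply: (le_trans (hI x)); rewrite ler_piMr// /I indicE.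
  by rewrite -[leRHS](mulr1n 1) ler_nat leq_b1.
pose F (z : measurableTypeR R * T) : R := h z.1 * I z.1 * ((mu - X z.2) * tail z.1 z.2).
have m1 : measurable_fun setT (fun z : measurableTypeR R * T => z.1 : R).
  exact: measurable_fst.
have m2 : measurable_fun setT (fun z : measurableTypeR R * T => X z.2).
  by apply: measurableT_comp; [|exact: measurable_snd].
have mF : measurable_fun setT F.
  apply: measurable_funM; apply: measurable_funM.
  - exact: (measurableT_comp mh m1).
  - exact: (measurableT_comp mI m1).
  - exact: measurable_funB.
  - apply: measurableT_comp; first exact: measurable_indic.
    exact: measurable_funB.
pose E0 := \int[P]_t `|mu - X t|.
have inorm : P.-integrable setT (EFin \o (fun t => `|mu - X t|)).
  exact: integrable_norm.
(* The integral of |F| over the sample space is at most C E|mu - X| for x in [-n, n) and 0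
   elsewhere, hence integrable over the line. *)
have iF : (leb \x P)%E.-integrable setT (EFin \o F).
  apply/integrable12ltyP; first exact/measurable_EFinP.
  apply: (@le_lt_trans _ _ (\int[leb]_x (C * E0 * I x)%:E)%E); last first.
    have /integrableP[_] : leb.-integrable setT (EFin \o (fun x => C * E0 * I x)).
      exact: (integrable_scale _ _ (integrable_indic_itv _ _ _ _)).
    apply: le_lt_trans; rewrite -[leLHS]/(\int[leb]_x _)%E.
    apply: ge0_le_integral => //.
    - move=> x _; rewrite lee_fin !mulr_ge0//; exact: Rintegral_ge0.
    - by apply/measurable_EFinP; apply: measurable_funM.
    - by apply: measurableT_comp => //; apply/measurable_EFinP; apply: measurable_funM.
    - by move=> x _; rewrite lee_fin ler_norm.
  have IC x : (\int[P]_t `|(F (x, t))%:E| <= (C * E0 * I x)%:E)%E.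
    apply: (@le_trans _ _ (\int[P]_t (C * I x * `|mu - X t|)%:E)%E).
      apply: ge0_le_integral => //.
      - apply/measurable_EFinP; apply: measurableT_comp => //.
        exact: (measurableT_comp mF (pair1_measurable x)).
      - apply/measurable_EFinP; apply: measurable_funM => //.
        by apply: measurableT_comp => //; exact: measurable_funB.
      - move=> t _; rewrite lee_fin /F normrM ler_pM//.
        have /andP[i0 i1] := ind01 `[0, +oo[%classic (x - X t).
        by rewrite normrM ler_piMr// ger0_norm.
    under eq_integral do rewrite EFinM.
    rewrite integralZl// -[X in (_ * X <= _)%E]fineK; last exact: integrable_fin_num.
    by rewrite -EFinM lee_fin mulrAC.
  apply: ge0_le_integral => //.
  - by move=> x _; exact: integral_ge0.
  - apply: (measurable_fun_fubini_tonelli_F (abse \o (EFin \o F))) => //.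
      by apply: measurableT_comp => //; exact/measurable_EFinP.
    by move=> z; exact: abse_ge0.
  - by apply/measurable_EFinP; apply: measurable_funM.
  - by move=> x _; exact: IC.
rewrite /Rintegral; congr fine.
rewrite (integral_density X f mf f0 fX (fun x => q x * h x * I x)); last 2 first.
- by apply: measurable_funM => //; exact: measurable_funM.
- apply: (integrable_fourth X mu EX4 (fun x => q x * h x * I x)
    ((`|dl| + `|bt| + `|gm|) * (`|c2| + `|c1| + `|c0|))).
    by apply: measurable_funM => //; exact: measurable_funM.
  move=> x; have /andP[i0 i1] := ind01 `[- n%:R, n%:R[%classic x.
  rewrite normrM (ger0_norm i0) (le_trans (ler_piMr _ i1))// normrM.
  apply: (le_trans (ler_pM _ _ (pearson_q_bound mu dl bt gm x)
    (pearson_q_bound mu c2 c1 c0 x))) => //.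
  by rewrite le_eqVlt; apply/orP; left; apply/eqP; ring.
transitivity (\int[leb]_x \int[P]_t (F (x, t))%:E)%E.
  apply: eq_integral => x _.
  rewrite (_ : q x * h x * I x * f x = h x * I x * (q x * f x)); last by ring.
  rewrite pearson_continuous_cumulative EFinM /Rintegral fineK; last first.
    exact: (integrable_fin_num measurableT (icent_tail x)).
  by rewrite -integralZl//; exact: icent_tail.
rewrite (Fubini iF); apply: eq_integral => t _.
rewrite EFinM -(integral_derivative_clamp (fun x => (x - mu) ^+ k) h)//.
rewrite -integralZl//.
  by apply: eq_integral => x _; rewrite -EFinM /F /tail; congr (_%:E); rewrite /=; ring.
have iI : leb.-integrable setT (EFin \o (fun x => C * I x)).
  exact: (integrable_scale _ _ (integrable_indic_itv _ _ _ _)).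
have : leb.-integrable setT (EFin \o (fun x : measurableTypeR R =>
    h x * I x * \1_(`[0, +oo[%classic : set R) (x - X t))); last by [].
apply: integrable_dominated iI _.
  apply: measurable_funM; first exact: measurable_funM.
  apply: measurableT_comp; first exact: measurable_indic.
  exact: measurable_funB.
move=> x; have /andP[i0 i1] := ind01 `[0, +oo[%classic (x - X t).
by rewrite normrM (ger0_norm i0) (le_trans (ler_piMr _ i1)).
Qed.

Lemma pearson_continuous_moments :
  [/\ dl * cmoment X mu 2 + gm = cmoment X mu 2,
      2 * dl * cmoment X mu 3 + 2 * bt * cmoment X mu 2 = cmoment X mu 3 &
      3 * dl * cmoment X mu 4 + 3 * bt * cmoment X mu 3 + 3 * gm * cmoment X mu 2
        = cmoment X mu 4].
Proof.
have eqn := pearson_moment_equation X mu EX EX4 dl bt gm.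
have dk k (x : R) : is_derive x (1 : R) (fun y => (y - mu) ^+ k.+1)
    (k.+1%:R * (x - mu) ^+ k).
  have h : is_derive x (1 : R) ((fun y : R => y - mu) ^+ k.+1)
    (k.+1%:R *: (x - mu) ^+ k *: (1 - 0 : R)) by exact: is_deriveX.
  rewrite exprfctE in h; by apply: (is_derive_eq h); rewrite subr0 /GRing.scale/= mulr1.
have d1 (x : R) : is_derive x (1 : R) (fun y => (y - mu) ^+ 1) (pearson_q 0 0 1 mu x).
  by apply: (is_derive_eq (dk 0 x)); rewrite /pearson_q; ring.
have d2 (x : R) : is_derive x (1 : R) (fun y => (y - mu) ^+ 2) (pearson_q 0 2 0 mu x).
  by apply: (is_derive_eq (dk 1 x)); rewrite /pearson_q; ring.
have d3 (x : R) : is_derive x (1 : R) (fun y => (y - mu) ^+ 3) (pearson_q 3 0 0 mu x).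
  by apply: (is_derive_eq (dk 2 x)); rewrite /pearson_q; ring.
have e1 := eqn 0 0 1 1%N isT (fun n => continuous_truncation _ _ _ 1 n d1).
have e2 := eqn 0 2 0 2%N isT (fun n => continuous_truncation _ _ _ 2 n d2).
have e3 := eqn 3 0 0 3%N isT (fun n => continuous_truncation _ _ _ 3 n d3).
by split; lra.
Qed.

End continuous_pearson.

(** * Positivity of Theta *)

Section theta_gt0.
Context {d : measure_display} {T : measurableType d} {R : realType}.
Context {P : probability T R}.
Variables (X : {RV P >-> R}) (mu : R).
Hypothesis EX : ('E_P[X] = mu%:E)%E.
Hypothesis EX4 : ('E_P[fun t => (X t ^+ 4)%R] < +oo)%E.
(** Nondegeneracy in a form common to both cases: the law is not concentrated on at most two
    points. *)
Hypothesis three_points : forall S : set R, measurable S ->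
  P (X @^-1` ~` S) = 0%E ->
  exists x y z, [/\ x != y, x != z, y != z & [/\ S x, S y & S z]].

(** A zero integral makes h(X) vanish almost surely, so that the zero set of [h] has full
    probability and contains three distinct points. *)
Let sqr_integral_gt0 (h : R -> R) : measurable_fun setT h ->
  (forall x y z, x != y -> x != z -> y != z -> h x = 0 -> h y = 0 -> h z = 0 ->
    False) ->
  P.-integrable setT (EFin \o (fun t => h (X t) ^+ 2)) ->
  0 < \int[P]_t (h (X t) ^+ 2).
Proof.
move=> mh h3 ih; rewrite lt_neqAle Rintegral_ge0 ?andbT; last first.
  by move=> t _; exact: sqr_ge0.
apply/eqP => e0.
have mS : measurable [set x | h x = 0].
  by rewrite -[X in measurable X]setTI; exact: (mh measurableT [set 0]).
have [|x [y [z [xy xz yz [hx hy hz]]]]] := three_points _ mS; last first.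
  exact: (h3 x y z).
have : (\int[P]_t `|(h (X t) ^+ 2)%:E| = 0)%E.
  under eq_integral do rewrite gee0_abs ?lee_fin ?sqr_ge0//.
  move: e0; rewrite /Rintegral => e0.
  by rewrite -[LHS]fineK ?(integrable_fin_num measurableT ih)// -e0.
move=> /(ae_eq_integral_abs _ measurableT (measurable_int _ ih)) [N [mN N0 hN]].
apply: (subset_measure0 _ mN _ N0).
  by apply: measurable_funPTI; exact: measurableC.
move=> t /= ht; apply: hN => /= /(_ I) e; apply: ht; apply/eqP.
by rewrite -sqrf_eq0; apply/eqP/EFin_inj.
Qed.

Lemma cmoment2_gt0 : 0 < cmoment X mu 2.
Proof.
rewrite cmomentE; apply: (sqr_integral_gt0 (fun x => x - mu)).
- exact: measurable_funB.
- move=> x y z /eqP xy _ _ hx hy _; apply: xy.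
  by apply: (addIr (- mu)); rewrite hx hy.
- exact: integrable_centered_power.
Qed.

Lemma ThetaF_cmoment_gt0 :
  0 < ThetaF (cmoment X mu 2) (cmoment X mu 3) (cmoment X mu 4).
Proof.
have m2 := cmoment2_gt0; set M2 := cmoment X mu 2 in m2 *.
set M3 := cmoment X mu 3; set M4 := cmoment X mu 4.
have M2n : M2 != 0 by rewrite gt_eqF.
(* The residual of y^2 after orthogonal projection on 1 and y, where y = x - mu. *)
pose h := pearson_q 1 (- (M3 / M2)) (- M2) mu.
have e : (\int[P]_t (h (X t) ^+ 2)) * M2 = ThetaF M2 M3 M4.
  have -> : \int[P]_t (h (X t) ^+ 2) = \int[P]_t (M2 ^+ 2 +
     (2 * M3) * (X t - mu) + (M3 ^+ 2 / M2 ^+ 2 - 2 * M2) * (X t - mu) ^+ 2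
     + (- (2 * M3 / M2)) * (X t - mu) ^+ 3 + 1 * (X t - mu) ^+ 4).
    by apply: eq_Rintegral => t _; rewrite /h /pearson_q; field.
  by rewrite Rintegral_quartic// -/M2 -/M3 -/M4 /ThetaF; field.
rewrite -e mulr_gt0//; apply: (sqr_integral_gt0 h).
- exact: measurable_pearson_q.
- move=> x y z xy xz yz hx hy hz.
  have : (1 : R) = 0.
    apply: (quadratic_three_roots 1 (- (M3 / M2)) (- M2) (x - mu) (y - mu) (z - mu)) => //.
    - by apply: contra xy => /eqP/addIr ->.
    - by apply: contra xz => /eqP/addIr ->.
    - by apply: contra yz => /eqP/addIr ->.
  by move/eqP; rewrite oner_eq0.
- apply: (integrable_fourth X mu EX4 (fun x => h x ^+ 2)
     ((`|1| + `|- (M3 / M2)| + `|- M2|) ^+ 2)).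
    by apply: measurable_funX; exact: measurable_pearson_q.
  move=> x; have hb := pearson_q_bound mu 1 (- (M3 / M2)) (- M2) x.
  rewrite normrX; apply: (@le_trans _ _ (((`|1| + `|- (M3 / M2)| + `|- M2|)
    * (`|x| + `|mu| + 1) ^+ 2) ^+ 2)).
    by rewrite lerXn2r ?nnegrE// mulr_ge0 ?sqr_ge0// !addr_ge0.
  by rewrite exprMn -exprM.
Qed.

End theta_gt0.

(** * Sample moments: expansion about a fixed point, and positivity *)

Section sample_moments.
Context {T : Type} {R : realType}.
Variable Xs : nat -> T -> R.

Local Notation cmom := (sample_cmoment Xs).

(** With a fixed centre the summands are functions of single observations, as the strong law
    requires; those of [sample_cmoment] all involve the sample mean. *)
Definition sample_moment_about (mu : R) (k n : nat) (t : T) : R :=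
  n%:R^-1 * \sum_(j < n) (Xs j t - mu) ^+ k.

(** Binomial expansion of (X_j - mu - s 1)^k, where [s 1] is the sample mean minus [mu]. For n = 0
    all averages are 0. *)
Lemma sample_cmoment_expand (mu : R) (n : nat) (t : T) :
  let s k := sample_moment_about mu k n t in
  [/\ cmom 2 n t = s 2%N - s 1%N ^+ 2,
      cmom 3 n t = s 3%N - 3 * s 1%N * s 2%N + 2 * s 1%N ^+ 3 &
      cmom 4 n t = s 4%N - 4 * s 1%N * s 3%N + 6 * s 1%N ^+ 2 * s 2%N
        - 3 * s 1%N ^+ 4].
Proof.
rewrite /=; have [->|n0] := posnP n.
  by rewrite /sample_cmoment /sample_moment_about !big_ord0 !mulr0 !expr0n/=
    !mulr0 !subr0 !addr0.
have nR : n%:R != 0 :> R by rewrite pnatr_eq0 -lt0n.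
set s := fun k => sample_moment_about mu k n t.
have s0 : s 0%N = 1.
  rewrite /s /sample_moment_about (eq_bigr (fun=> 1)); last by move=> j _; rewrite expr0.
  by rewrite sumr_const card_ord mulVf.
have mean : sample_mean Xs n t = mu + s 1%N.
  rewrite /sample_mean /s /sample_moment_about sumrB sumr_const card_ord.
  by rewrite mulrBr -[mu *+ n]mulr_natl mulKf// addrC subrK.
(* By linearity of averages, a polynomial identity in y transfers with y^i replaced by [s i]; five
   coefficients cover all degrees up to 4. *)
have lin (c : 'I_5 -> R) k :
    (forall y : R, (y - s 1%N) ^+ k = \sum_(i < 5) c i * y ^+ i) ->
    cmom k n t = \sum_(i < 5) c i * s i.
  move=> ck; rewrite /sample_cmoment mean.
  under eq_bigr do rewrite opprD addrA ck.
  rewrite exchange_big/= mulr_sumr; apply: eq_bigr => i _.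
  by rewrite -mulr_sumr mulrCA.
pose nthc (l : seq R) (i : 'I_5) := l`_i.
rewrite -/(s 1%N) -/(s 2%N) -/(s 3%N) -/(s 4%N); split.
- rewrite (lin (nthc [:: s 1%N ^+ 2; - 2 * s 1%N; 1; 0; 0])).
    by rewrite !big_ord_recr big_ord0 /nthc/= s0; ring.
  by move=> y; rewrite !big_ord_recr big_ord0 /nthc/=; ring.
- rewrite (lin (nthc [:: - s 1%N ^+ 3; 3 * s 1%N ^+ 2; - 3 * s 1%N; 1; 0])).
    by rewrite !big_ord_recr big_ord0 /nthc/= s0; ring.
  by move=> y; rewrite !big_ord_recr big_ord0 /nthc/=; ring.
- rewrite (lin (nthc [:: s 1%N ^+ 4; - 4 * s 1%N ^+ 3; 6 * s 1%N ^+ 2;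
    - 4 * s 1%N; 1])).
    by rewrite !big_ord_recr big_ord0 /nthc/= s0; ring.
  by move=> y; rewrite !big_ord_recr big_ord0 /nthc/=; ring.
Qed.

(** The population argument for the empirical measure: an average of squares that is not positive
    makes the quadratic residual vanish at every observation, hence at three distinct points. *)
Lemma sample_ThetaF_gt0 (n : nat) (t : T) (i j k : nat) :
  (i < n)%N -> (j < n)%N -> (k < n)%N ->
  Xs i t != Xs j t -> Xs i t != Xs k t -> Xs j t != Xs k t ->
  0 < cmom 2 n t /\ 0 < ThetaF (cmom 2 n t) (cmom 3 n t) (cmom 4 n t).
Proof.
move=> iltn jltn kltn ij ik jk.
have n0 : (0 < n)%N by exact: leq_ltn_trans iltn.
have nR : 0 < n%:R^-1 :> R by rewrite invr_gt0 ltr0n.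
have sq0 (h : R -> R) : n%:R^-1 * \sum_(l < n) h (Xs l t) ^+ 2 <= 0 ->
    forall l, (l < n)%N -> h (Xs l t) = 0.
  rewrite pmulr_rle0// => h0 l ln.
  have s0 : \sum_(l < n) h (Xs l t) ^+ 2 = 0.
    by apply/eqP; rewrite eq_le h0 sumr_ge0// => ? _; exact: sqr_ge0.
  have := @psumr_eq0P _ _ _ _ (fun (l : 'I_n) _ => sqr_ge0 (h (Xs l t))) s0.
  by move/(_ (Ordinal ln) isT)/eqP; rewrite sqrf_eq0/= => /eqP.
pose mb := sample_mean Xs n t.
have m2 : 0 < cmom 2 n t.
  rewrite ltNge; apply/negP => /(sq0 (fun x => x - mb)) h0.
  by move/eqP: ij; apply; apply: (addIr (- mb)); rewrite !h0.
split=> //.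
have M2n : cmom 2 n t != 0 by rewrite gt_eqF.
have m1 : n%:R^-1 * \sum_(l < n) (Xs l t - mb) = 0.
  rewrite sumrB sumr_const card_ord mulrBr -[mb *+ n]mulr_natl mulKf ?subrr//.
  by rewrite pnatr_eq0 -lt0n.
set M2 := cmom 2 n t in m2 M2n *; set M3 := cmom 3 n t; set M4 := cmom 4 n t.
pose h x := pearson_q 1 (- (M3 / M2)) (- M2) mb x.
have e : (n%:R^-1 * \sum_(l < n) h (Xs l t) ^+ 2) * M2 = ThetaF M2 M3 M4.
  have -> : n%:R^-1 * \sum_(l < n) h (Xs l t) ^+ 2 =
      M4 - 2 * M3 / M2 * M3 + (M3 ^+ 2 / M2 ^+ 2 - 2 * M2) * M2
      + M2 ^+ 2.
    transitivity (n%:R^-1 * \sum_(l < n) ((Xs l t - mb) ^+ 4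
       + (- (2 * M3 / M2)) * (Xs l t - mb) ^+ 3
       + (M3 ^+ 2 / M2 ^+ 2 - 2 * M2) * (Xs l t - mb) ^+ 2
       + 2 * M3 * (Xs l t - mb) + M2 ^+ 2)).
      by congr (_ * _); apply: eq_bigr => l _; rewrite /h /pearson_q; field.
    rewrite !big_split/= sumr_const card_ord -!mulr_sumr !mulrDr.
    rewrite -[M2 ^+ 2 *+ n]mulr_natl mulKf; last by rewrite pnatr_eq0 -lt0n.
    rewrite !(mulrCA n%:R^-1) -/(cmom 4 n t) -/(cmom 3 n t) -/(cmom 2 n t).
    by rewrite m1 mulr0 addr0 mulNr.
  by rewrite /ThetaF; field.
rewrite -e mulr_gt0// ltNge; apply/negP => /(sq0 h) h0.
have : (1 : R) = 0.
  apply: (quadratic_three_roots 1 (- (M3 / M2)) (- M2)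
     (Xs i t - mb) (Xs j t - mb) (Xs k t - mb)).
  - by apply: contra ij => /eqP/addIr ->.
  - by apply: contra ik => /eqP/addIr ->.
  - by apply: contra jk => /eqP/addIr ->.
  - exact: (h0 i).
  - exact: (h0 j).
  - exact: (h0 k).
by move/eqP; rewrite oner_eq0.
Qed.

End sample_moments.

(** * Consistency of the estimators *)

Section estimator_continuity.
Context {R : realType}.
Variables (u v w : nat -> R) (a b c : R).
Hypothesis ua : u n @[n --> \oo] --> a.
Hypothesis vb : v n @[n --> \oo] --> b.
Hypothesis wc : w n @[n --> \oo] --> c.
Hypothesis theta_gt0 : 0 < ThetaF a b c.

Let cX (s : nat -> R) (l : R) k : s n @[n --> \oo] --> l ->
  s n ^+ k @[n --> \oo] --> l ^+ k.
Proof. by move=> sl; exact: (cvg_comp _ _ sl (@exprn_continuous _ k l)). Qed.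

Local Ltac cvg_poly :=
  lazymatch goal with
  | |- cvg_to _ (nbhs (_ + _)) => apply: cvgD; cvg_poly
  | |- cvg_to _ (nbhs (- _)) => apply: cvgN; cvg_poly
  | |- cvg_to _ (nbhs (_ * _)) => apply: cvgM; cvg_poly
  | |- cvg_to _ (nbhs (_ ^+ _)) => apply: cX; cvg_poly
  | |- cvg_to _ (nbhs a) => exact: ua
  | |- cvg_to _ (nbhs b) => exact: vb
  | |- cvg_to _ (nbhs c) => exact: wc
  | |- _ => exact: cvg_cst
  end.

Let cden : (6 * ThetaF (u n) (v n) (w n))^-1 @[n --> \oo] -->
  (6 * ThetaF a b c)^-1.
Proof.
apply: cvgV; first by rewrite mulf_neq0// gt_eqF.
by rewrite /ThetaF; cvg_poly.
Qed.

Lemma cvg_deltaA : deltaA (u n) (v n) (w n) @[n --> \oo] --> deltaA a b c.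
Proof. by apply: cvgM; [cvg_poly|exact: cden]. Qed.

Lemma cvg_betaA : betaA (u n) (v n) (w n) @[n --> \oo] --> betaA a b c.
Proof. by apply: cvgM; [cvg_poly|exact: cden]. Qed.

Lemma cvg_gammaA : gammaA (u n) (v n) (w n) @[n --> \oo] --> gammaA a b c.
Proof. by apply: cvgM; [cvg_poly|exact: cden]. Qed.

Lemma cvg_deltaB : deltaB (u n) (v n) (w n) @[n --> \oo] --> deltaB a b c.
Proof. by apply: cvgM; [cvg_poly|exact: cden]. Qed.

Lemma cvg_betaB : betaB (u n) (v n) (w n) @[n --> \oo] --> betaB a b c.
Proof. by apply: cvgM; [cvg_poly|exact: cden]. Qed.

Lemma cvg_gammaB : gammaB (u n) (v n) (w n) @[n --> \oo] --> gammaB a b c.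
Proof. by apply: cvgM; [cvg_poly|exact: cden]. Qed.

End estimator_continuity.

(** * Convergence of the sample moments and nondegeneracy of the two kinds of law *)

Section sampling.
Context {d : measure_display} {T : measurableType d} {R : realType}.
Context {P : probability T R}.
Variables (X : {RV P >-> R}) (Xs : nat -> {RV P >-> R}) (mu : R).
Hypothesis sampleX : random_sample X Xs.

(** The strong law applies to the averages about [mu]; the sample central moments are polynomials in
    these, in which [s 1] tends to 0. *)
Lemma sample_cmoment_consistent :
  ('E_P[X] = mu%:E)%E -> ('E_P[fun t => (X t ^+ 4)%R] < +oo)%E ->
  {ae P, forall t,
    [/\ sample_cmoment Xs 2 n t @[n --> \oo] --> cmoment X mu 2,
        sample_cmoment Xs 3 n t @[n --> \oo] --> cmoment X mu 3 &
        sample_cmoment Xs 4 n t @[n --> \oo] --> cmoment X mu 4]}.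
Proof.
move=> EX EX4.
have sl k : (k <= 4)%N -> {ae P, forall t,
    sample_moment_about Xs mu k n t @[n --> \oo] --> cmoment X mu k}.
  move=> k4; rewrite cmomentE.
  apply: (strong_law X Xs sampleX (fun x => (x - mu) ^+ k)).
    by apply: measurable_funX; exact: measurable_funB.
  exact: integrable_centered_power.
have [s1 s2 s3 s4] := And4 (sl 1%N isT) (sl 2%N isT) (sl 3%N isT) (sl 4%N isT).
apply: filterS2 (filterI s1 s2) (filterI s3 s4) => t [c1 c2] [c3 c4].
rewrite (cmoment1 X mu EX EX4) in c1.
pose s k n := sample_moment_about Xs mu k n t.
have cX k (f : nat -> R) (l : R) : f n @[n --> \oo] --> l ->
    f n ^+ k @[n --> \oo] --> l ^+ k.
  by move=> fl; exact: (cvg_comp _ _ fl (@exprn_continuous _ k l)).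
have sE n := sample_cmoment_expand Xs mu n t.
split.
- rewrite (_ : (fun n => _) = fun n => s 2%N n - s 1%N n ^+ 2); last first.
    by apply/funext => n; have [] := sE n.
  (* The limit takes the shape of the expansion, 0 standing for the limit of [s 1]. *)
  rewrite (_ : cmoment X mu 2 = cmoment X mu 2 - 0 ^+ 2); last first.
    by rewrite expr0n subr0.
  by apply: cvgB => //; exact: cX.
- rewrite (_ : (fun n => _) = fun n =>
    s 3%N n - 3 * s 1%N n * s 2%N n + 2 * s 1%N n ^+ 3); last first.
    by apply/funext => n; have [] := sE n.
  rewrite (_ : cmoment X mu 3 = cmoment X mu 3 - 3 * 0 * cmoment X mu 2
     + 2 * 0 ^+ 3); last by ring.
  apply: cvgD; last by apply: cvgM; [exact: cvg_cst|exact: cX].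
  apply: cvgB => //; apply: cvgM => //.
  by apply: cvgM => //; exact: cvg_cst.
- rewrite (_ : (fun n => _) = fun n => s 4%N n - 4 * s 1%N n * s 3%N n
    + 6 * s 1%N n ^+ 2 * s 2%N n - 3 * s 1%N n ^+ 4); last first.
    by apply/funext => n; have [] := sE n.
  rewrite (_ : cmoment X mu 4 = cmoment X mu 4 - 4 * 0 * cmoment X mu 3
     + 6 * 0 ^+ 2 * cmoment X mu 2 - 3 * 0 ^+ 4); last by ring.
  apply: cvgB; last by apply: cvgM; [exact: cvg_cst|exact: cX].
  apply: cvgD; last first.
    apply: cvgM => //; apply: cvgM; [exact: cvg_cst|exact: cX].
  apply: cvgB => //; apply: cvgM => //.
  by apply: cvgM => //; exact: cvg_cst.
Qed.

Lemma ae_sample_neq (i j : nat) : (forall x, P (X @^-1` [set x]) = 0%E) ->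
  i != j -> {ae P, forall t, Xs i t != Xs j t}.
Proof.
move=> X0 ij.
have N0 : P [set t | Xs i t = Xs j t] = 0%E.
  apply: independent_eq_negligible => [A B mA mB|x].
    by apply: mutually_independent_pair => //; exact: sampleX.1.
  by rewrite sampleX.2.
exists [set t | Xs i t = Xs j t]; split => //.
  have -> : [set t | Xs i t = Xs j t] =
      (fun t => Xs i t - Xs j t) @^-1` [set 0].
    by apply/seteqP; split => t /=; [move=> ->; rewrite subrr|move/subr0_eq].
  by rewrite -[X in measurable X]setTI; apply: measurable_funB.
by move=> t /= /negP; rewrite negbK => /eqP.
Qed.

(** An atom of positive mass belongs to every set of full probability. *)
Lemma three_points_of_atoms (x y z : R) (S : set R) :
  x != y -> x != z -> y != z ->
  0 < pmf X x -> 0 < pmf X y -> 0 < pmf X z ->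
  measurable S -> P (X @^-1` ~` S) = 0%E ->
  exists x y z, [/\ x != y, x != z, y != z & [/\ S x, S y & S z]].
Proof.
move=> xy xz yz px py pz mS S0.
have atom a : 0 < pmf X a -> S a.
  move=> pa; apply: contrapT => Sa; move: pa; rewrite /pmf.
  have mXa : measurable (X @^-1` [set a]) by exact: measurable_funPTI.
  have mXC : measurable (X @^-1` ~` S).
    by apply: measurable_funPTI; exact: measurableC.
  by rewrite (subset_measure0 mXa mXC _ S0) ?ltxx// => t /= ->.
by exists x, y, z; split => //; split; exact: atom.
Qed.

Lemma three_points_of_diffuse (S : set R) :
  (forall x, P (X @^-1` [set x]) = 0%E) ->
  measurable S -> P (X @^-1` ~` S) = 0%E ->
  exists x y z, [/\ x != y, x != z, y != z & [/\ S x, S y & S z]].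
Proof.
move=> X0 mS S0.
(* A set of full probability is not contained in a null set. The three points are chosen one after
   the other, each outside the null set formed by its predecessors. *)
have pick (A : set R) : measurable A -> P (X @^-1` A) = 0%E ->
    exists x, S x /\ ~ A x.
  move=> mA A0; apply: contrapT => nex.
  have sub : S `<=` A.
    by move=> x Sx; apply: contrapT => nA; apply: nex; exists x.
  have : P setT = 0%E.
    have mXS : measurable (X @^-1` S) by exact: measurable_funPTI.
    have mXC : measurable (X @^-1` ~` S).
      by apply: measurable_funPTI; exact: measurableC.
    rewrite -(preimage_setT X) -(setUv S) preimage_setU null_set_setU//.
    apply: (subset_measure0 mXS _ _ A0); first exact: measurable_funPTI.
    exact: preimage_subset.
  by rewrite probability_setT => /eqP; rewrite onee_eq0.
have [x [Sx _]] := pick set0 measurable0 (measure0 P).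
have [y [Sy yx]] := pick [set x] (measurable_set1 x) (X0 x).
have [|z [Sz zxy]] := pick ([set x] `|` [set y])
    (measurableU _ _ (measurable_set1 x) (measurable_set1 y)).
  have mX1 u : measurable (X @^-1` [set u]) by exact: measurable_funPTI.
  by rewrite preimage_setU null_set_setU//; first [exact: mX1|exact: X0].
exists x, y, z; split => //; apply/eqP => e.
- by apply: yx; rewrite e.
- by apply: zxy; left; rewrite /= e.
- by apply: zxy; right; rewrite /= e.
Qed.

End sampling.

Lemma three_distinct_values {R : realType} (x : nat -> R) (n : nat) :
  (3 <= size (undup [seq x j | j <- iota 0 n]))%N ->
  exists i j k, [/\ (i < n)%N, (j < n)%N & (k < n)%N] /\
    [/\ x i != x j, x i != x k & x j != x k].
Proof.
set s := undup _ => s3.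
have us : uniq s by exact: undup_uniq.
have sx l : (l < 3)%N -> exists2 i, (i < n)%N & s`_l = x i.
  move=> l3; have : s`_l \in s by rewrite mem_nth// (leq_trans l3).
  by rewrite mem_undup => /mapP[i]; rewrite mem_iota add0n => /andP[_ ?] ?; exists i.
have [i iltn si] := sx 0%N isT.
have [j jltn sj] := sx 1%N isT.
have [k kltn sk] := sx 2%N isT.
exists i, j, k; split => //.
by rewrite -si -sj -sk !nth_uniq// (leq_trans _ s3).
Qed.

(** * Both cases assembled from the moment equations, positivity and consistency *)

Theorem theorem2p1 (d : measure_display) (T : measurableType d) (R : realType)
    (P : probability T R) :
  (* (a) integer-valued case *)
  (forall (X : {RV P >-> R}) (Xs : nat -> {RV P >-> R})
          (mu delta beta gamma : R),
    random_sample X Xs ->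
    (forall t, X t \is a Num.int) ->
    ('E_P[X] = mu%:E)%E ->
    ('E_P[fun t => (X t ^+ 4)%R] < +oo)%E ->
    pearson_discrete (fun j : int => pmf X j%:~R) delta beta gamma mu ->
    (exists j1 j2 j3 : int, [/\ j1 != j2, j1 != j3, j2 != j3 &
        [/\ 0 < pmf X j1%:~R, 0 < pmf X j2%:~R & 0 < pmf X j3%:~R]]) ->
    let m2 := sample_cmoment Xs 2 in
    let m3 := sample_cmoment Xs 3 in
    let m4 := sample_cmoment Xs 4 in
    [/\ (* the population parameters as functions of the central moments *)
        let mu2 := cmoment X mu 2 in
        let mu3 := cmoment X mu 3 in
        let mu4 := cmoment X mu 4 in
        [/\ 0 < ThetaF mu2 mu3 mu4, delta = deltaA mu2 mu3 mu4,
            beta = betaA mu2 mu3 mu4 & gamma = gammaA mu2 mu3 mu4],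
        (* Theta_n > 0 whenever the sample has >= 3 distinct values,
           together with the alternative forms of the estimators *)
        (forall (n : nat) (w : T),
           (3 <= size (undup [seq Xs j w | j <- iota 0 n]))%N ->
           [/\ 0 < ThetaF (m2 n w) (m3 n w) (m4 n w),
               betaA (m2 n w) (m3 n w) (m4 n w)
                 = (m3 n w * (1 - 2 * deltaA (m2 n w) (m3 n w) (m4 n w))
                     - m2 n w) / (2 * m2 n w) &
               gammaA (m2 n w) (m3 n w) (m4 n w)
                 = m2 n w * (1 - deltaA (m2 n w) (m3 n w) (m4 n w))]),
        {ae P, forall w, (fun n => deltaA (m2 n w) (m3 n w) (m4 n w))
                           @ \oo --> delta},
        {ae P, forall w, (fun n => betaA (m2 n w) (m3 n w) (m4 n w))
                           @ \oo --> beta} &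
        {ae P, forall w, (fun n => gammaA (m2 n w) (m3 n w) (m4 n w))
                           @ \oo --> gamma}]) /\
  (* (b) continuous case *)
  (forall (X : {RV P >-> R}) (Xs : nat -> {RV P >-> R}) (f : R -> R)
          (mu delta beta gamma : R),
    random_sample X Xs ->
    measurable_fun setT f -> (forall x, 0 <= f x) ->
    (forall A : set R, measurable A ->
       P (X @^-1` A) = (\int[@lebesgue_measure R]_(x in A) (f x)%:E)%E) ->
    ('E_P[X] = mu%:E)%E ->
    ('E_P[fun t => (X t ^+ 4)%R] < +oo)%E ->
    pearson_continuous f delta beta gamma mu ->
    let m2 := sample_cmoment Xs 2 in
    let m3 := sample_cmoment Xs 3 in
    let m4 := sample_cmoment Xs 4 in
    [/\ let mu2 := cmoment X mu 2 in
        let mu3 := cmoment X mu 3 in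
        let mu4 := cmoment X mu 4 in
        [/\ 0 < ThetaF mu2 mu3 mu4, delta = deltaB mu2 mu3 mu4,
            beta = betaB mu2 mu3 mu4 & gamma = gammaB mu2 mu3 mu4],
        (forall n : nat, (3 <= n)%N ->
           {ae P, forall w,
             [/\ 0 < ThetaF (m2 n w) (m3 n w) (m4 n w),
                 betaB (m2 n w) (m3 n w) (m4 n w)
                   = m3 n w * (1 - 2 * deltaB (m2 n w) (m3 n w) (m4 n w))
                       / (2 * m2 n w) &
                 gammaB (m2 n w) (m3 n w) (m4 n w)
                   = m2 n w * (1 - deltaB (m2 n w) (m3 n w) (m4 n w))]}),
        {ae P, forall w, (fun n => deltaB (m2 n w) (m3 n w) (m4 n w))
                           @ \oo --> delta},
        {ae P, forall w, (fun n => betaB (m2 n w) (m3 n w) (m4 n w))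
                           @ \oo --> beta} &
        {ae P, forall w, (fun n => gammaB (m2 n w) (m3 n w) (m4 n w))
                           @ \oo --> gamma}]).
Proof.
split.
- move=> X Xs mu delta beta gamma sX intX EX EX4 pX
    [j1 [j2 [j3 [j12 j13 j23 [p1 p2 p3]]]]] m2 m3 m4.
  have three S := three_points_of_atoms X j1%:~R j2%:~R j3%:~R S
    (etrans (congr1 negb (eqr_int _ _ _)) j12)
    (etrans (congr1 negb (eqr_int _ _ _)) j13)
    (etrans (congr1 negb (eqr_int _ _ _)) j23) p1 p2 p3.
  have M2 := cmoment2_gt0 X mu EX4 three.
  have Th := ThetaF_cmoment_gt0 X mu EX EX4 three.
  have [e1 e2 e3] := pearson_discrete_moments X mu delta beta gamma intX EX EX4 pX.
  have [ed eb eg] := pearson_solveA M2 Th e1 e2 e3.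
  have cons := sample_cmoment_consistent X Xs mu sX EX EX4.
  split => //.
  + move=> n w /(three_distinct_values (fun j => Xs j w))
      [i [j [k [[iltn jltn kltn] [ij ik jk]]]]].
    have [s2 sTh] := sample_ThetaF_gt0 (fun j => Xs j : T -> R) n w i j k
      iltn jltn kltn ij ik jk.
    by split; [exact: sTh|exact: betaA_alt|exact: gammaA_alt].
  (* The parameter is the same function of the population moments as the estimator is of the sample
     moments, so continuity suffices. *)
  + by rewrite ed; apply: filterS cons => w [c2 c3 c4]; exact: cvg_deltaA.
  + by rewrite eb; apply: filterS cons => w [c2 c3 c4]; exact: cvg_betaA.
  + by rewrite eg; apply: filterS cons => w [c2 c3 c4]; exact: cvg_gammaA.
- move=> X Xs f mu delta beta gamma sX mf f0 fX EX EX4 pX m2 m3 m4.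
  have X0 := density_no_atom X f fX.
  have three S := three_points_of_diffuse X S X0.
  have M2 := cmoment2_gt0 X mu EX4 three.
  have Th := ThetaF_cmoment_gt0 X mu EX EX4 three.
  have [e1 e2 e3] := pearson_continuous_moments X f mu delta beta gamma mf f0 fX EX EX4 pX.
  have [ed eb eg] := pearson_solveB M2 Th e1 e2 e3.
  have cons := sample_cmoment_consistent X Xs mu sX EX EX4.
  split => //.
  + move=> n n3.
    (* Already the first three observations are almost surely distinct. *)
    have n01 := ae_sample_neq X Xs sX 0 1 X0 isT.
    have n02 := ae_sample_neq X Xs sX 0 2 X0 isT.
    have n12 := ae_sample_neq X Xs sX 1 2 X0 isT.
    apply: filterS2 n01 (filterI n02 n12) => w ij [ik jk].
    have [s2 sTh] := sample_ThetaF_gt0 (fun j => Xs j : T -> R) n w 0 1 2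
      (ltnW (ltnW n3)) (ltnW n3) n3 ij ik jk.
    by split; [exact: sTh|exact: betaB_alt|exact: gammaB_alt].
  + by rewrite ed; apply: filterS cons => w [c2 c3 c4]; exact: cvg_deltaB.
  + by rewrite eb; apply: filterS cons => w [c2 c3 c4]; exact: cvg_betaB.
  + by rewrite eg; apply: filterS cons => w [c2 c3 c4]; exact: cvg_gammaB.
Qed.
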